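(* Let $X$ be an exact $2$-convex rearrangement invariant space of measurable functions on $(0,\infty)$ (with Lebesgue measure). Then \[ \left\| \frac{\sin \pi t}{\pi t}\right\|_X \le \left\| e^{-\pi t^2/2}\right\|_X , \] where both functions are regarded as functions of $t\in(0,\infty)$ and $\|h\|_X:=+\infty$ if $h\notin X$.
   Context: A rearrangement invariant (r.i.) space $X$ on $(0,\infty)$ is a Banach function lattice such that if $g^*\le f^*$ and $f\in X$ then $g\in X$ and $\|g\|_X\le\|f\|_X$, where $f^*(s)=\inf\{\tau>0:\ |\{|f|>\tau\}|\le s\}$ is the nonincreasing rearrangement. For $1\le p<\infty$, a Banach lattice $E$ is called exact $p$-convex if for all finite families $f_1,\dots,f_n\in E$, $\bigl\|(\sum_{k=1}^n|f_k|^p)^{1/p}\bigr\|_E\le(\sum_{k=1}^n\|f_k\|_E^p)^{1/p}$. *)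

(* Defs.v *)
From HB Require Import structures.
From mathcomp Require Import all_boot all_order all_algebra.
From mathcomp Require Import all_classical all_reals all_analysis.
Set Implicit Arguments. Unset Strict Implicit. Unset Printing Implicit Defensive.
Import Order.TTheory GRing.Theory Num.Theory.
Import numFieldNormedType.Exports.
Local Open Scope classical_set_scope.
Local Open Scope ring_scope.

(* Functions are f : R -> R, regarded on (0, +oo) with Lebesgue measure;
   values outside (0,+oo) are irrelevant. *)

Definition pos_half (R : realType) : set R := `]0, +oo[%classic.

Definition distrib (R : realType) (f : R -> R) (tau : R) : \bar R :=
  (@lebesgue_measure R) [set x | 0 < x /\ tau < `|f x|].

Definition rearr (R : realType) (f : R -> R) (s : R) : \bar R :=
  ereal_inf [set (tau%:E)%E | tau in [set tau : R | 0 < tau /\ (distrib f tau <= s%:E)%E]].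

(* An (extended) function norm N : (R -> R) -> \bar R describes the space
   X = { f | N f < +oo } with norm ||f||_X = N f, and N f = +oo when f \notin X. *)
Definition inX (R : realType) (N : (R -> R) -> \bar R) (f : R -> R) : Prop :=
  (N f < +oo)%E.

Record ri_space (R : realType) (N : (R -> R) -> \bar R) : Prop := {
  ri_meas : forall f : R -> R, inX N f -> measurable_fun (@pos_half R) f;
  ri_ge0 : forall f : R -> R, (0 <= N f)%E;
  ri_eq0 : forall f : R -> R, inX N f ->
     (N f = 0%E <-> (@lebesgue_measure R) [set x | 0 < x /\ f x != 0] = 0%E);
  ri_homog : forall (a : R) (f : R -> R), inX N f -> N (fun x => (a * f x)%R) = (`|a|%:E * N f)%E;
  ri_triangle : forall f g : R -> R, (N (fun x => (f x + g x)%R) <= N f + N g)%E;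
  ri_complete : forall u : nat -> R -> R, (forall n, inX N (u n)) ->
     (forall e : R, 0 < e -> exists n0 : nat, forall m n : nat,
        (n0 <= m)%N -> (n0 <= n)%N -> (N (fun x => (u m x - u n x)%R) < e%:E)%E) ->
     exists f, inX N f /\
       (forall e : R, 0 < e -> exists n0 : nat, forall n : nat,
          (n0 <= n)%N -> (N (fun x => (u n x - f x)%R) < e%:E)%E);
  ri_lattice : forall f g : R -> R, inX N f -> measurable_fun (@pos_half R) g ->
     (forall x, 0 < x -> `|g x| <= `|f x|) -> (N g <= N f)%E;
  ri_rearr : forall f g : R -> R, inX N f -> measurable_fun (@pos_half R) g ->
     (forall s, 0 < s -> (rearr g s <= rearr f s)%E) -> (N g <= N f)%E
}.

Definition exact_2_convex (R : realType) (N : (R -> R) -> \bar R) : Prop :=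
  forall (n : nat) (f : 'I_n -> R -> R), (forall k, inX N (f k)) ->
    (N (fun x => Num.sqrt (\sum_(k < n) (f k x) ^+ 2))
       <= (Num.sqrt (\sum_(k < n) (fine (N (f k))) ^+ 2))%:E)%E.

(* Main.v *)
Require Import Defs.
From HB Require Import structures.
From mathcomp Require Import all_boot all_order all_algebra perm.
From mathcomp Require Import all_classical all_reals all_analysis.
From mathcomp Require Import measurable_realfun ring lra.
Import Order.TTheory GRing.Theory Num.Theory.
Import numFieldNormedType.Exports.
Local Open Scope classical_set_scope.
Local Open Scope ring_scope.

(** Write F and G for the distribution functions of |sin(pi t)/(pi t)| and of
    exp(-pi t^2/2).  As shown by Nazarov and Podkorytov, F - G changes sign
    exactly once, so the decreasing rearrangement of the first function lies
    below the second one before some point s0 and above it afterwards.  Both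
    functions have the same L^2 norm, hence the squares are comparable in the
    sense of Hardy-Littlewood-Polya.  After discretization on equal cells this
    comparison is a finite chain of T-transforms, and exact 2-convexity together
    with rearrangement invariance says precisely that a T-transform of the
    squares does not increase the norm.  The tail of sinc is negligible in X since
    2-convexity and completeness let the norm of X be dominated by an l^2 sum
    over unit intervals. *)

Set Implicit Arguments.
Unset Strict Implicit.
Unset Printing Implicit Defensive.

(** * Real-variable estimates *)

Section real_variable.
Context {R : realType}.
Implicit Types x y : R.

(** Since [gauss] decreases from 1 to 0, the crossing is the sign of F(gauss s) - s. At high levels
    only the main lobe of sinc counts, at low levels explicit pieces of several lobes are measured,
    and in between it is enough that F(gauss s) - s be monotone, which the rising side of the second
    lobe alone provides. Of the equality of L^2 norms two inequalities are used: the integral of the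
    squared sinc is at most 1/2, by a Fejer kernel that dominates it and has an explicit primitive,
    and that of the squared Gaussian is at least 1/2. Discretization costs small errors in these
    sums. They are paid for by inflating the Gaussian by 1 + e, but only before s0: an inflation
    after s0 could destroy the single sign change. The gain on (0, s0) is of order e, and e tends to
    0 at the end. That sinc lies in X is not known in advance, so the tail is identified through a
    limit supplied by completeness. *)

Lemma MVT_derive (f df : R -> R) (a b : R) : a < b ->
  (forall x, a <= x <= b -> is_derive x 1 f (df x)) ->
  exists c, [/\ a < c, c < b & f b - f a = df c * (b - a)].
Proof.
move=> ab fE; have [| |c] := @MVT R f df a b ab.
- by move=> x; rewrite in_itv => /andP[ax xb]; apply: fE; rewrite !ltW.
- apply: derivable_within_continuous => x; rewrite in_itv => /fE D.
  by apply: ex_derive.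
by rewrite in_itv/= => /andP[ac cb] fab; exists c.
Qed.

Lemma derive_ge0_le (f df : R -> R) (a b : R) : a <= b ->
  (forall x, a <= x <= b -> is_derive x 1 f (df x)) ->
  (forall x, a < x -> x < b -> 0 <= df x) -> f a <= f b.
Proof.
rewrite le_eqVlt => /predU1P[->//|ab] fE df0.
have [c [ac cb fc]] := MVT_derive ab fE.
by rewrite -subr_ge0 fc mulr_ge0// ?df0// subr_ge0 ltW.
Qed.

Lemma is_derive_monomial (c x : R) (n : nat) :
  is_derive x 1 (fun u => u ^+ n.+1 * c) (n.+1%:R * c * x ^+ n).
Proof.
have -> : (fun u : R => u ^+ n.+1 * c) = c *: ((id : R -> R) ^+ n.+1).
  by apply/funext => u; rewrite !fctE/= mulrC.
apply: is_derive_eq (is_deriveZ c (is_deriveX n.+1 (is_derive_id x 1))) _.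
by rewrite /GRing.scale/= mulr1; ring.
Qed.
Local Existing Instance is_derive_monomial.

(** Each Taylor bound below is the previous one integrated from 0, where the difference vanishes. *)
Lemma sin_le_id x : 0 <= x -> sin x <= x.
Proof.
move=> x0; suff : 0 - sin 0 <= x - sin x by rewrite sin0 subrr subr_ge0.
apply: (@derive_ge0_le (fun u => u - sin u) (fun u => 1 - cos u)); first by [].
by move=> u _ _; rewrite subr_ge0 cos_le1.
Qed.

Lemma cos_ge_taylor2 x : 0 <= x -> 1 - x ^+ 2 / 2 <= cos x.
Proof.
move=> x0.
suff : cos 0 - (1 - 0 ^+ 2 / 2) <= cos x - (1 - x ^+ 2 / 2) by rewrite cos0; lra.
apply: (@derive_ge0_le (fun u => cos u - (1 - u ^+ 2 / 2)) (fun u => u - sin u)); first by [].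
  by move=> u _; apply: is_derive_eq; rewrite /GRing.scale/=; lra.
by move=> u u0 _; rewrite subr_ge0; apply: sin_le_id; exact: ltW.
Qed.

Lemma sin_ge_taylor3 x : 0 <= x -> x - x ^+ 3 / 6 <= sin x.
Proof.
move=> x0.
suff : sin 0 - (0 - 0 ^+ 3 / 6) <= sin x - (x - x ^+ 3 / 6) by rewrite sin0; lra.
apply: (@derive_ge0_le (fun u => sin u - (u - u ^+ 3 / 6))
  (fun u => cos u - (1 - u ^+ 2 / 2))); first by [].
  by move=> u _; apply: is_derive_eq; rewrite /GRing.scale/=; lra.
by move=> u u0 _; rewrite subr_ge0; apply: cos_ge_taylor2; exact: ltW.
Qed.

Lemma cos_le_taylor4 x : 0 <= x -> cos x <= 1 - x ^+ 2 / 2 + x ^+ 4 / 24.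
Proof.
move=> x0.
suff : (1 - 0 ^+ 2 / 2 + 0 ^+ 4 / 24) - cos 0 <=
  (1 - x ^+ 2 / 2 + x ^+ 4 / 24) - cos x by rewrite cos0; lra.
apply: (@derive_ge0_le (fun u => (1 - u ^+ 2 / 2 + u ^+ 4 / 24) - cos u)
  (fun u => sin u - (u - u ^+ 3 / 6))); first by [].
  by move=> u _; apply: is_derive_eq; rewrite /GRing.scale/=; lra.
by move=> u u0 _; rewrite subr_ge0; apply: sin_ge_taylor3; exact: ltW.
Qed.

Lemma sin_le_taylor5 x : 0 <= x -> sin x <= x - x ^+ 3 / 6 + x ^+ 5 / 120.
Proof.
move=> x0.
suff : (0 - 0 ^+ 3 / 6 + 0 ^+ 5 / 120) - sin 0 <=
  (x - x ^+ 3 / 6 + x ^+ 5 / 120) - sin x by rewrite sin0; lra.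
apply: (@derive_ge0_le (fun u => (u - u ^+ 3 / 6 + u ^+ 5 / 120) - sin u)
  (fun u => 1 - u ^+ 2 / 2 + u ^+ 4 / 24 - cos u)); first by [].
  by move=> u _; apply: is_derive_eq; rewrite /GRing.scale/=; lra.
by move=> u u0 _; rewrite subr_ge0; apply: cos_le_taylor4; exact: ltW.
Qed.

Lemma cos_ge_taylor6 x : 0 <= x ->
  1 - x ^+ 2 / 2 + x ^+ 4 / 24 - x ^+ 6 / 720 <= cos x.
Proof.
move=> x0.
suff : cos 0 - (1 - 0 ^+ 2 / 2 + 0 ^+ 4 / 24 - 0 ^+ 6 / 720) <=
  cos x - (1 - x ^+ 2 / 2 + x ^+ 4 / 24 - x ^+ 6 / 720) by rewrite cos0; lra.
apply: (@derive_ge0_le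
  (fun u => cos u - (1 - u ^+ 2 / 2 + u ^+ 4 / 24 - u ^+ 6 / 720))
  (fun u => u - u ^+ 3 / 6 + u ^+ 5 / 120 - sin u)); first by [].
  by move=> u _; apply: is_derive_eq; rewrite /GRing.scale/=; lra.
by move=> u u0 _; rewrite subr_ge0; apply: sin_le_taylor5; exact: ltW.
Qed.

(** The cosine is still positive at 31/20, so 31/20 comes before pi/2. The value 3.1 is enough for
    21/64 > 1/pi. *)
Lemma pi_gt31 : (31 / 10 : R) < pi.
Proof.
have c0 : 0 < cos (31 / 20 : R).
  by apply: lt_le_trans (cos_ge_taylor6 _); lra.
rewrite ltNge; apply/negP => pile.
suff : cos (31 / 20 : R) <= cos (pi / 2) by rewrite cos_pihalf leNgt c0.
have p0 := @pi_ge2 R; rewrite leNgt; apply/negP.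
by rewrite ltr_cos ?in_itv/=; lra.
Qed.

(** 16/5 is exactly the threshold for the slope bound with constant 3/4 on the second lobe. *)
Lemma pi_lt32 : (pi : R) < 32 / 10.
Proof.
have c0 : cos (16 / 10 : R) < 0.
  by apply: le_lt_trans (cos_le_taylor4 _) _; lra.
rewrite ltNge; apply/negP => pile.
suff : 0 <= cos (16 / 10 : R) by rewrite leNgt c0.
by apply: cos_ge0_pihalf; have := @pi_gt0 R; lra.
Qed.

Lemma sin_pisub x : sin (pi - x) = sin x.
Proof. by rewrite sinB sinpi cospi; ring. Qed.

Lemma sin_pi6 : sin (pi / 6 : R) = 1 / 2.
Proof.
have p0 := @pi_gt0 R.
have s0 : 0 < sin (pi / 6 : R) by apply: sin_gt0_pi; lra.
have : cos (pi / 6 *+ 2 : R) = sin (pi / 6).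
  by rewrite -cosBpihalf -cosN; congr cos; field.
rewrite cos_mulr2n cos2sin2 => H.
(* With s = sin(pi/6), the relation s = cos(pi/3) = 1 - 2 s^2 factors. *)
have /eqP : (2 * sin (pi / 6 : R) - 1) * (sin (pi / 6) + 1) = 0.
  by rewrite -[X in _ * (X + _)]H; move: H; rewrite -mulr_natl; nra.
rewrite mulf_eq0 => /orP[/eqP|/eqP]; lra.
Qed.

Lemma sin_pi3_ge : 866 / 1000 <= sin (pi / 3 : R).
Proof.
have p0 := @pi_gt0 R.
have s0 : 0 < sin (pi / 3 : R) by apply: sin_gt0_pi; lra.
have c : cos (pi / 3 : R) = 1 / 2.
  by rewrite -sin_pi6 -cosBpihalf -cosN; congr cos; field.
have := cos2Dsin2 (pi / 3 : R); rewrite c; nra.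
Qed.

Lemma sin_cos_pi4 : sin (pi / 4 : R) = cos (pi / 4).
Proof. by rewrite -cosBpihalf -cosN; congr cos; field. Qed.

Lemma sin_pi4_bounds : 707 / 1000 < sin (pi / 4 : R) < 708 / 1000.
Proof.
have p0 := @pi_gt0 R.
have s0 : 0 < sin (pi / 4 : R) by apply: sin_gt0_pi; lra.
by have := cos2Dsin2 (pi / 4 : R); rewrite -sin_cos_pi4; nra.
Qed.

Lemma cos_lt_pi x y : 0 <= x -> x < y -> y <= pi -> cos y < cos x.
Proof. by move=> x0 xy yp; rewrite ltr_cos ?in_itv/=; lra. Qed.

(** Concavity of sin on [0, pi]: if the line exceeded sin at [u], mean value points on the two sides
    of [u] would have cosines in the wrong order. *)
Lemma sin_concave_above (c d a b u : R) : 0 <= a -> a <= u -> u <= b -> b <= pi ->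
  c + d * a <= sin a -> c + d * b <= sin b -> c + d * u <= sin u.
Proof.
move=> a0; rewrite le_eqVlt => /predU1P[<-//|au].
rewrite le_eqVlt => /predU1P[->//|ub] bp ha hb.
pose phi x := sin x - (c + d * x).
have phiE x : is_derive x 1 phi (cos x - d).
  by apply: is_derive_eq; rewrite /GRing.scale/=; ring.
have [v [av vu Ev]] := MVT_derive au (fun x _ => phiE x).
have [w [uw wb Ew]] := MVT_derive ub (fun x _ => phiE x).
have : cos w < cos v by apply: cos_lt_pi; lra.
move: Ev Ew; rewrite /phi => Ev Ew H; rewrite leNgt; apply/negP => L.
have : (cos v - d) * (u - a) < 0 by rewrite -Ev; lra.
have : 0 < (cos w - d) * (b - u) by rewrite -Ew; lra.
rewrite pmulr_lgt0 ?subr_gt0// pmulr_llt0 ?subr_gt0//; lra.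
Qed.
End real_variable.

(** * Pointwise bounds for sinc and the Gaussian *)

Section sinc_gauss.
Context {R : realType}.
Implicit Types x y u v s : R.

Definition sinc x : R := sin (pi * x) / (pi * x).
Definition gauss x : R := expR (- (pi * x ^+ 2) / 2).

Lemma mul_cos_le_sin u : 0 <= u -> u <= pi -> u * cos u <= sin u.
Proof.
move=> u0 up; suff : sin 0 - 0 * cos 0 <= sin u - u * cos u by rewrite sin0; lra.
apply: (@derive_ge0_le R (fun v => sin v - v * cos v) (fun v => v * sin v)); first by [].
  by move=> v _; apply: is_derive_eq; rewrite /GRing.scale/=; ring.
by move=> v v0 vu; rewrite mulr_ge0 ?sin_ge0_pi//; lra.
Qed.

(** The product of cos v and exp(v^2/2) decreases from 1, its derivative having the sign of v cos v
    - sin v. *)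
Lemma cos_le_gauss u : 0 <= u -> u <= pi / 2 -> cos u <= expR (- (u ^+ 2 / 2)).
Proof.
move=> u0 up; rewrite expRN -[leRHS]mul1r ler_pdivlMr ?expR_gt0//.
suff : - (cos 0 * expR (0 ^+ 2 / 2)) <= - (cos u * expR (u ^+ 2 / 2)).
  by rewrite lerN2 cos0 expr0n/= mul0r expR0 mulr1.
apply: (@derive_ge0_le R (fun v => - (cos v * expR (v ^+ 2 / 2)))
  (fun v => expR (v ^+ 2 / 2) * (sin v - v * cos v))); first by [].
  by move=> v _; apply: is_derive_eq; rewrite /GRing.scale/=; lra.
move=> v v0 vu; rewrite mulr_ge0 ?expR_ge0// subr_ge0 mul_cos_le_sin//; last first.
  by have := @pi_gt0 R; lra.
exact: ltW.
Qed.

Lemma sin_double x : sin x = 2 * (cos (x / 2) * sin (x / 2)).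
Proof.
have -> : sin x = sin (x / 2 *+ 2) by congr sin; field.
by rewrite sin_mulr2n mulr_natl.
Qed.

(* Three halvings of the angle already give the Gaussian rate 1/4 + 1/16 + 1/64,
   and 21/64 > 1/pi. *)
Lemma sinc_le_gauss x : 0 < x -> x <= 1 -> sinc x <= gauss x.
Proof.
move=> x0 x1; have p31 := @pi_gt31 R.
rewrite /sinc ler_pdivrMr ?mulr_gt0// ?pi_gt0//.
set t := pi * x.
have t0 : 0 < t by rewrite mulr_gt0 ?pi_gt0.
have tp : t <= pi by rewrite ger_pMr ?pi_gt0.
have C a : 2 <= a -> 0 <= cos (t / a) <= expR (- ((t / a) ^+ 2 / 2)).
  move=> a2; have ta : t / a <= pi / 2 by rewrite ler_pM ?invr_ge0 ?lef_pV2 ?posrE; lra.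
  have ta0 : 0 <= t / a by rewrite divr_ge0; lra.
  by rewrite cos_le_gauss// cos_ge0_pihalf//; lra.
have /andP[c2 C2] := C 2 ltac:(lra); have /andP[c4 C4] := C 4 ltac:(lra).
have /andP[c8 C8] := C 8 ltac:(lra).
have S8 : sin (t / 8) <= t / 8 by rewrite sin_le_id//; lra.
have s8 : 0 <= sin (t / 8) by rewrite sin_ge0_pi//; lra.
have -> : sin t = 8 * (cos (t / 2) * cos (t / 4) * cos (t / 8) * sin (t / 8)).
  rewrite sin_double (sin_double (t / 2)) (sin_double (t / 2 / 2)).
  have -> : t / 2 / 2 = t / 4 by field.
  have -> : t / 4 / 2 = t / 8 by field.
  by ring.
have le : cos (t / 2) * cos (t / 4) * cos (t / 8) * sin (t / 8) <=
    expR (- ((t / 2) ^+ 2 / 2)) * expR (- ((t / 4) ^+ 2 / 2)) *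
    expR (- ((t / 8) ^+ 2 / 2)) * (t / 8).
  by rewrite !ler_pM ?mulr_ge0.
apply: (@le_trans _ _ (expR (- ((t / 2) ^+ 2 / 2)) * expR (- ((t / 4) ^+ 2 / 2)) *
    expR (- ((t / 8) ^+ 2 / 2)) * t)); first by lra.
rewrite ler_pM2r// -!expRD ler_expR /t.
suff : 0 <= (21 / 64 * pi - 1) * (pi * x ^+ 2) by lra.
by rewrite !mulr_ge0 ?sqr_ge0//; lra.
Qed.

Lemma norm_sin_addn x n : `|sin (pi * (n%:R + x))| = `|sin (pi * x)|.
Proof.
elim: n => [|n IH]; first by rewrite add0r.
have -> : pi * (n.+1%:R + x) = pi * (n%:R + x) + pi :> R by rewrite -natr1; ring.
by rewrite sinDpi normrN.
Qed.

Lemma norm_sincE x : 0 < x -> `|sinc x| = `|sin (pi * x)| / (pi * x).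
Proof. by move=> x0; rewrite normrM normfV (gtr0_norm (mulr_gt0 _ x0))// pi_gt0. Qed.

Lemma norm_sinc_le1 x : 0 < x -> `|sinc x| <= 1.
Proof.
move=> x0; have px0 : 0 < pi * x by rewrite mulr_gt0 ?pi_gt0.
rewrite norm_sincE// ler_pdivrMr// mul1r.
case: (leP 0 (sin (pi * x))) => s0.
  by rewrite ger0_norm// sin_le_id// ltW.
case: (leP 1 (pi * x)) => [|p1]; first exact/le_trans/sin_max.
have := @pi_gt31 R; have : 0 < sin (pi * x) by apply: sin_gt0_pi; have := @pi_gt31 R; lra.
lra.
Qed.

Lemma norm_sinc_le_inv x : 0 < x -> `|sinc x| <= (pi * x)^-1.
Proof.
move=> x0; rewrite norm_sincE// ler_pdivrMr ?mulr_gt0 ?pi_gt0//.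
by rewrite mulVf ?sin_max// gt_eqF// mulr_gt0 ?pi_gt0.
Qed.

(* By concavity of sin, a superlevel set of |sinc| meets a lobe in an interval. *)
Lemma norm_sinc_ge_lobe (n : nat) (a b c x : R) : 0 <= a -> b <= 1 ->
  n%:R + a <= x -> x <= n%:R + b -> 0 < x ->
  c * (n%:R + a) * pi <= sin (pi * a) -> c * (n%:R + b) * pi <= sin (pi * b) ->
  c <= `|sinc x|.
Proof.
move=> a0 b1 ax xb x0 ha hb; have p0 := @pi_gt0 R.
rewrite norm_sincE// ler_pdivlMr ?mulr_gt0//.
have <- : `|sin (pi * (x - n%:R))| = `|sin (pi * x)|.
  by rewrite -(norm_sin_addn _ n); congr (`|sin (pi * _)|); ring.
apply: le_trans (ler_norm _).
suff : c * n%:R * pi + c * (pi * (x - n%:R)) <= sin (pi * (x - n%:R)) by lra.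
apply: (@sin_concave_above R _ _ (pi * a) (pi * b)).
- by rewrite mulr_ge0// ltW.
- by rewrite ler_pM2l//; lra.
- by rewrite ler_pM2l//; lra.
- by rewrite ger_pMr.
- by lra.
- by lra.
Qed.

Lemma gauss_decr s s' : 0 <= s -> s < s' -> gauss s' < gauss s.
Proof.
move=> s0 ss; rewrite ltr_expR.
have : 0 < pi * (s' ^+ 2 - s ^+ 2) by rewrite mulr_gt0 ?pi_gt0//; nra.
lra.
Qed.

Lemma gauss_gt0 s : 0 < gauss s. Proof. exact: expR_gt0. Qed.

Lemma expR_ge_taylor3 x : 0 <= x -> 1 + x + x ^+ 2 / 2 + x ^+ 3 / 6 <= expR x.
Proof.
have D1 v : 0 <= v -> 1 + v <= expR v by move=> _; exact: expR_ge1Dx.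
have D2 v : 0 <= v -> 1 + v + v ^+ 2 / 2 <= expR v.
  move=> v0; suff : expR 0 - (1 + 0 + 0 ^+ 2 / 2) <= expR v - (1 + v + v ^+ 2 / 2).
    by rewrite expR0; lra.
  apply: (@derive_ge0_le R (fun u => expR u - (1 + u + u ^+ 2 / 2))
    (fun u => expR u - (1 + u))); first by [].
    by move=> u _; apply: is_derive_eq; rewrite /GRing.scale/=; lra.
  by move=> u u0 _; rewrite subr_ge0; apply: D1; exact: ltW.
move=> v0; suff : expR 0 - (1 + 0 + 0 ^+ 2 / 2 + 0 ^+ 3 / 6) <=
    expR x - (1 + x + x ^+ 2 / 2 + x ^+ 3 / 6).
  by rewrite expR0; lra.
apply: (@derive_ge0_le R (fun u => expR u - (1 + u + u ^+ 2 / 2 + u ^+ 3 / 6))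
  (fun u => expR u - (1 + u + u ^+ 2 / 2))); first by [].
  by move=> u _; apply: is_derive_eq; rewrite /GRing.scale/=; lra.
by move=> u u0 _; rewrite subr_ge0; apply: D2; exact: ltW.
Qed.

End sinc_gauss.

(** * The second lobe of |sinc| *)

Section second_lobe.
Context {R : realType}.
Implicit Types x y u v s : R.

(** This is |sinc| on [1, 2] in the angle u = pi (x - 1). *)
Definition lobe u : R := sin u / (pi + u).
(** Numerator of the derivative of [lobe]. Its own derivative -(pi + u) sin u is negative inside (0,
    pi), which makes the lobe unimodal. *)
Definition lobe_slope u : R := (pi + u) * cos u - sin u.

Lemma norm_sinc_lobe u : 0 <= u -> u <= pi -> `|sinc (1 + u / pi)| = lobe u.
Proof.
move=> u0 up; have p0 := @pi_gt0 R.
have up0 : 0 <= u / pi by rewrite divr_ge0// ltW.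
rewrite norm_sincE; last by lra.
rewrite (norm_sin_addn (u / pi) 1).
have -> : pi * (u / pi) = u by rewrite mulrC divfK ?gt_eqF.
have -> : pi * (1 + u / pi) = pi + u by rewrite mulrDr mulr1 mulrC mulrC [pi * _]mulrC divfK ?gt_eqF.
by rewrite ger0_norm// sin_ge0_pi// u0.
Qed.

Lemma is_derive_lobe u : 0 <= u -> is_derive u 1 lobe (lobe_slope u / (pi + u) ^+ 2).
Proof.
move=> u0; have p0 := @pi_gt0 R; have pu0 : pi + u != 0 by rewrite gt_eqF//; lra.
rewrite /lobe /lobe_slope; apply: is_derive_eq; rewrite /GRing.scale/=.
move: pu0; set a := pi + u; set S := sin u; set C := cos u => a0.
have -> : (a * C - S) / a ^+ 2 = a * C / (a * a) - S / a ^+ 2 by rewrite mulrBl expr2.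
by rewrite -mulf_div divff// mul1r add0r mulr1 mulrN addrC [C / a]mulrC.
Qed.

Lemma lobe_slope_decr u v : 0 <= u -> u < v -> v <= pi -> lobe_slope v < lobe_slope u.
Proof.
move=> u0 uv vp; have p0 := @pi_gt0 R.
have [c [uc cv]] := @MVT_derive R lobe_slope (fun u => - ((pi + u) * sin u)) u v uv
  (fun w _ => ltac:(rewrite /lobe_slope; apply: is_derive_eq; rewrite /GRing.scale/=; ring)).
move=> E; rewrite -subr_lt0 E mulNr oppr_lt0 !mulr_gt0 ?sin_gt0_pi ?subr_gt0//; lra.
Qed.

Lemma lobe_peak_exists : exists u1 : R,
  [/\ pi / 4 < u1, u1 < pi / 2, forall u, 0 <= u -> u < u1 -> 0 < lobe_slope u &
      forall u, u1 < u -> u <= pi -> lobe_slope u < 0].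
Proof.
have p0 := @pi_gt31 R; have s4 := @sin_pi4_bounds R.
have k4 : 0 < lobe_slope (pi / 4) by rewrite /lobe_slope -sin_cos_pi4; nra.
have k2 : lobe_slope (pi / 2) < 0 by rewrite /lobe_slope cos_pihalf sin_pihalf; lra.
have [||u1] := @IVT R lobe_slope (pi / 4) (pi / 2) 0 ltac:(lra).
- apply: derivable_within_continuous => x _.
  by apply: ex_derive; rewrite /lobe_slope; apply: is_derive_eq; rewrite /GRing.scale/=.
- by rewrite le_max ge_min (ltW k4) (ltW k2) orbT.
rewrite in_itv/= => /andP[l1 l2] k0.
have n4 : pi / 4 < u1 by rewrite lt_neqAle l1 andbT; apply: contraTN k4 => /eqP ->; rewrite k0 ltxx.
have n2 : u1 < pi / 2 by rewrite lt_neqAle l2 andbT; apply: contraTN k2 => /eqP <-; rewrite k0 ltxx.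
exists u1; split=> // u h1 h2; rewrite -k0; apply: lobe_slope_decr => //; lra.
Qed.

(** The value of |sinc| at 5/4. From here up to the peak, Gaussian levels are treated by
    monotonicity; below it, level sets are measured directly. *)
Definition lobe_low : R := lobe (pi / 4).

(* The rising side of the second lobe is so flat that, as the level decreases,
   the superlevel set of |sinc| grows there faster than that of the Gaussian. *)
Lemma lobe_rise_bound : exists u1 : R, [/\ pi / 4 < u1, u1 < pi / 2,
  forall u, 0 <= u -> u <= pi -> lobe u <= lobe u1 &
  forall u v, pi / 4 <= u -> u < v -> v <= u1 ->
    0 < lobe v - lobe u <= 3 / 4 * lobe_low * (v - u)].
Proof.
have [u1 [n4 n2 kpos kneg]] := lobe_peak_exists.
have p0 := @pi_gt31 R; have s4 := @sin_pi4_bounds R.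
exists u1; split=> //.
  move=> u u0 up; case: (leP u u1) => uu.
    apply: (@derive_ge0_le R lobe (fun u => lobe_slope u / (pi + u) ^+ 2)) => //.
      by move=> x /andP[ux xu1]; apply: is_derive_lobe; lra.
    by move=> x ux xu; rewrite divr_ge0 ?sqr_ge0// ltW// kpos//; lra.
  have D x : u1 <= x <= u -> is_derive x 1 lobe (lobe_slope x / (pi + x) ^+ 2).
    by move=> xu; apply: is_derive_lobe; lra.
  have [c [uc cv E]] := MVT_derive uu D.
  have : lobe_slope c / (pi + c) ^+ 2 <= 0.
    by rewrite pmulr_lle0 ?invr_gt0 ?exprn_gt0//; [apply/ltW/kneg; lra|lra].
  by move=> L; have : lobe u - lobe u1 <= 0; [rewrite E; nra|lra].
move=> u v u4 uv vu1.
have D x : u <= x <= v -> is_derive x 1 lobe (lobe_slope x / (pi + x) ^+ 2).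
  by move=> xu; apply: is_derive_lobe; lra.
have [c [uc cv ->]] := MVT_derive uv D.
have c0 : 0 < (pi + c) ^+ 2 by rewrite exprn_gt0//; lra.
rewrite mulr_gt0 ?divr_gt0 ?kpos ?subr_gt0//=; try lra.
rewrite ler_pM2r ?subr_gt0// ler_pdivrMr//.
apply: (@le_trans _ _ (lobe_slope (pi / 4))); first by apply/ltW/lobe_slope_decr; lra.
(* After division by sin(pi/4) = cos(pi/4) this reads 5 pi/4 - 1 <= 15 pi/16, that is pi <= 16/5. *)
have kE : lobe_slope (pi / 4) <= 3 / 4 * (sin (pi / 4) * (pi + pi / 4)).
  by rewrite /lobe_slope -sin_cos_pi4; have p32 := @pi_lt32 R; nra.
apply: (le_trans kE).
have -> : sin (pi / 4) * (pi + pi / 4) = lobe_low * (pi + pi / 4) ^+ 2.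
  by rewrite /lobe_low /lobe; field; rewrite gt_eqF//; lra.
rewrite -[leRHS]mulrA ler_pM2l; last by lra.
rewrite ler_pM2l; first by rewrite lerXn2r ?nnegrE; lra.
by rewrite divr_gt0; lra.
Qed.
End second_lobe.

(** * The crossing of the distribution functions *)

Section distribution.
Context {R : realType}.
Implicit Types (f g : R -> R) (x y s t : R).
Local Notation mu := (@lebesgue_measure R).
Local Open Scope ereal_scope.

Lemma pos_halfE x : pos_half x <-> (0 < x)%R.
Proof. by rewrite /pos_half /= in_itv/= andbT. Qed.

Lemma measurable_superlevel f t : measurable_fun (@pos_half R) f ->
  measurable [set x | (0 < x)%R /\ (t < `|f x|)%R].
Proof.
move=> mf; have mn : measurable_fun (@pos_half R) (fun x => `|f x|)%R.
  exact: measurableT_comp.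
have := mn (measurable_itv _) `]t, +oo[%classic (measurable_itv _).
congr (measurable _); apply/seteqP; split => x /=; rewrite /pos_half /= !in_itv/= !andbT//.
Qed.

Lemma distrib_antitone f s t : measurable_fun (@pos_half R) f -> (s <= t)%R ->
  distrib f t <= distrib f s.
Proof.
move=> mf st; apply: le_measure; rewrite ?inE; try exact: measurable_superlevel.
by move=> x [x0 tx]; split=> //; exact: le_lt_trans tx.
Qed.

Lemma le_distrib f (A : set R) t : measurable_fun (@pos_half R) f -> measurable A ->
  (forall x, A x -> (0 < x)%R /\ (t < `|f x|)%R) -> mu A <= distrib f t.
Proof.
move=> mf mA h; apply: le_measure; rewrite ?inE//; exact: measurable_superlevel.
Qed.

Lemma distrib_le_itv f t s : measurable_fun (@pos_half R) f -> (0 <= s)%R ->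
  (forall x, (0 < x)%R -> (t < `|f x|)%R -> (x <= s)%R) -> distrib f t <= s%:E.
Proof.
move=> mf s0 h; have -> : s%:E = mu `[0%R, s]%classic.
  by rewrite lebesgue_measure_itv/= lte_fin; case: ltgtP s0 => // <-; rewrite ?sube0.
apply: le_measure; rewrite ?inE; [exact: measurable_superlevel|exact: measurable_itv|].
by move=> x [x0 tx]/=; rewrite in_itv/= (ltW x0) h.
Qed.

Lemma lebesgue_measure_oo (a b : R) : (a <= b)%R -> mu `]a, b[%classic = (b - a)%:E.
Proof.
move=> ab; rewrite lebesgue_measure_itv/= lte_fin; case: ltgtP ab => // <-.
by rewrite subrr.
Qed.

Lemma le_distrib_itv2 f t (a b c d : R) : measurable_fun (@pos_half R) f ->
  (0 <= a)%R -> (a <= b)%R -> (b <= c)%R -> (c <= d)%R ->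
  (forall x, (a < x < b)%R -> (t < `|f x|)%R) ->
  (forall x, (c < x < d)%R -> (t < `|f x|)%R) ->
  ((b - a) + (d - c))%:E <= distrib f t.
Proof.
move=> mf a0 ab bc cd h1 h2.
rewrite EFinD -!lebesgue_measure_oo// -measureU; try exact: measurable_itv.
  apply: le_distrib => //; first by apply: measurableU; exact: measurable_itv.
  move=> x /= []; rewrite in_itv/= => /andP[l r]; (split; first lra).
  - by apply: h1; rewrite l.
  - by apply: h2; rewrite l.
by apply/seteqP; split => // x /= []; rewrite !in_itv/=; lra.
Qed.

Lemma measurable_sinc : measurable_fun (@pos_half R) (@sinc R).
Proof.
apply: subspace_continuous_measurable_fun; first exact: measurable_itv.
apply: derivable_within_continuous => x /pos_halfE x0.
have n0 : (pi * x != 0 :> R)%R by rewrite mulf_neq0 ?gt_eqF ?pi_gt0.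
by apply: ex_derive; rewrite /sinc; apply: is_derive_eq.
Qed.

Lemma distrib_sinc_le y : (0 < y)%R -> distrib (@sinc R) y <= ((pi * y)^-1)%:E.
Proof.
move=> y0; have p0 := @pi_gt0 R.
apply: distrib_le_itv; [exact: measurable_sinc|by rewrite invr_ge0 mulr_ge0// ltW|].
move=> x x0 /lt_le_trans/(_ (norm_sinc_le_inv x0)).
rewrite -[ltRHS]mul1r -[leRHS]mul1r ltr_pdivlMr ?mulr_gt0// ler_pdivlMr ?mulr_gt0//.
lra.
Qed.

Lemma distrib_sinc_fin y : (0 < y)%R -> distrib (@sinc R) y \is a fin_num.
Proof.
move=> y0; rewrite ge0_fin_numE ?measure_ge0//.
exact: le_lt_trans (distrib_sinc_le y0) (ltry _).
Qed.

End distribution.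

(** * Level sets of sinc at Gaussian levels *)

Section crossing.
Context {R : realType}.
Implicit Types (x y s t u v : R).
Local Notation mu := (@lebesgue_measure R).
Local Notation F := (distrib (@sinc R)).

Lemma gauss_lt_decr s s' : 0 <= s' -> gauss s < gauss s' -> s' < s \/ s < 0.
Proof.
move=> s0 h; case: (ltP s 0) => [|s1]; [by right|left].
rewrite ltNge le_eqVlt; apply/negP => /predU1P[E|/(gauss_decr s1)].
  by move: h; rewrite E ltxx.
by move=> /(lt_trans h); rewrite ltxx.
Qed.

Lemma lobe_low_bounds : 565 / 1000 < lobe_low * pi :> R /\ lobe_low * pi < 567 / 1000 :> R.
Proof.
have -> : lobe_low * pi = 4 / 5 * sin (pi / 4) :> R.
  rewrite /lobe_low /lobe; have p0 := @pi_gt0 R.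
  have -> : pi + pi / 4 = 5 / 4 * pi :> R by field.
  by rewrite invfM mulrA divfK ?gt_eqF//; field.
have := @sin_pi4_bounds R; lra.
Qed.

(** Above the height of the second lobe a superlevel set sees only the main lobe, where sinc is
    below the Gaussian; past x = 2 the bound 1/(pi x) is already under [lobe_low]. *)
Lemma distrib_sinc_le_peak u1 s :
  (forall u, 0 <= u -> u <= pi -> lobe u <= lobe u1) ->
  0 < s -> lobe u1 <= gauss s -> (F (gauss s) <= s%:E)%E.
Proof.
move=> peak s0 hs; have p0 := @pi_gt31 R; have [l1 _] := lobe_low_bounds.
have low : lobe_low <= lobe u1 by apply: peak; lra.
apply: distrib_le_itv; [exact: measurable_sinc|exact: ltW|move=> x x0 hx].
case: (leP x 1) => x1.
  have : gauss s < gauss x.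
    apply: lt_le_trans hx _; rewrite ger0_norm ?sinc_le_gauss//.
    have px0 : 0 <= pi * x by rewrite mulr_ge0 ?pi_ge0// ltW.
    by rewrite /sinc divr_ge0// sin_ge0_pi// px0 ger_pMr ?pi_gt0.
  by move=> h; case: (gauss_lt_decr (ltW x0) h); lra.
exfalso; case: (leP x 2) => x2.
  have E : x = 1 + (pi * (x - 1)) / pi by rewrite [pi * _]mulrC mulfK ?gt_eqF ?pi_gt0//; ring.
  move: hx; rewrite E norm_sinc_lobe; [|by rewrite mulr_ge0; lra|by rewrite ger_pMr; lra].
  apply/negP; rewrite -leNgt (le_trans _ hs)// peak//.
    by rewrite mulr_ge0; lra.
  by rewrite ger_pMr; lra.
have := lt_le_trans hx (norm_sinc_le_inv x0).
apply/negP; rewrite -leNgt (le_trans _ hs)// (le_trans _ low)//.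
rewrite -[leLHS]mul1r ler_pdivrMr; last by rewrite mulr_gt0; lra.
have : 1 <= (lobe_low * pi) * 2 :> R by lra.
by move=> /le_trans; apply; rewrite mulrA ler_pM2l; lra.
Qed.

(** Lowering the level from gauss s to gauss s' adds at least the piece of the rising side of the
    second lobe between the two levels, and this piece has length at least s' - s. Thus F(gauss s) -
    s does not decrease in this range. *)
Lemma distrib_sinc_step u1 s s' :
  (forall u, 0 <= u -> u <= pi -> lobe u <= lobe u1) ->
  (forall u v, pi / 4 <= u -> u < v -> v <= u1 ->
    0 < lobe v - lobe u <= 3 / 4 * lobe_low * (v - u)) ->
  pi / 4 < u1 -> u1 < pi / 2 ->
  3 / 4 <= s -> s < s' -> lobe_low <= gauss s' -> gauss s <= lobe u1 ->
  (F (gauss s) + (s' - s)%:E <= F (gauss s'))%E.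
Proof.
move=> peak rise u14 u12 s34 ss low high; have p0 := @pi_gt31 R.
have gs : gauss s' < gauss s by apply: gauss_decr => //; lra.
have cl (a b : R) : 0 <= a -> {within `[a, b], continuous (@lobe R)}.
  move=> a0; apply: derivable_within_continuous => x; rewrite in_itv/= => /andP[ax _].
  by have D := is_derive_lobe (le_trans a0 ax); apply: ex_derive.
have [||v] := @IVT R lobe (pi / 4) u1 (gauss s) (ltW u14).
- by apply: cl; lra.
- rewrite ge_min le_max high orbT andbT; apply/orP; left.
  by rewrite -/lobe_low (le_trans low)// ltW.
rewrite in_itv/= => /andP[v4 vu1] Ev.
have [||v'] := @IVT R lobe (pi / 4) v (gauss s') v4.
- by apply: cl; lra.
- by rewrite ge_min le_max Ev (ltW gs) orbT andbT -/lobe_low low.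
rewrite in_itv/= => /andP[v'4 v'v] Ev'.
have vv : v' < v.
  rewrite lt_neqAle v'v andbT; apply: contraTN gs => /eqP E.
  by rewrite -Ev -Ev' E ltxx.
have /andP[_ slope] := rise _ _ v'4 vv vu1.
(* The two constants 3/4 cancel: by exp y >= 1 + y the Gaussian drops by at least lobe_low pi (s'^2
   - s^2)/2, the lobe has slope at most 3/4 lobe_low, and (s + s')/2 >= 3/4. *)
have len : s' - s <= (v - v') / pi.
  have z0 : 0 <= pi * (s' ^+ 2 - s ^+ 2) / 2 by rewrite divr_ge0// mulr_ge0//; nra.
  have gE : gauss s = gauss s' * expR (pi * (s' ^+ 2 - s ^+ 2) / 2).
    by rewrite /gauss -expRD; congr expR; field.
  have h1 : gauss s' * (pi * (s' ^+ 2 - s ^+ 2) / 2) <= gauss s - gauss s'.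
    rewrite gE -[X in _ <= _ - X]mulr1 -mulrBr ler_pM2l ?gauss_gt0//.
    by have := expR_ge1Dx (pi * (s' ^+ 2 - s ^+ 2) / 2); lra.
  have h2 : lobe_low * (pi * (s' ^+ 2 - s ^+ 2) / 2) <= 3 / 4 * lobe_low * (v - v').
    apply: le_trans slope; rewrite Ev Ev'; apply: le_trans h1; exact: ler_wpM2r.
  have l0 : 0 < lobe_low :> R.
    have [h _] := lobe_low_bounds; have := lt_trans _ h.
    by move=> /(_ 0 ltac:(lra)); rewrite pmulr_lgt0// pi_gt0.
  rewrite ler_pdivlMr ?pi_gt0//.
  move: h2; rewrite -[leRHS]mulrA [leRHS]mulrCA ler_pM2l// => h2.
  have h3 : (s' - s) * pi * (3 / 4) <= (s' - s) * pi * ((s' + s) / 2).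
    by rewrite ler_pM2l; [lra|rewrite mulr_gt0//; lra].
  lra.
have len0 : v' / pi <= v / pi by rewrite ler_pM2r ?invr_gt0 ?pi_gt0// ltW.
apply: (@le_trans _ _ (F (gauss s) + ((1 + v / pi) - (1 + v' / pi))%:E)%E).
  by rewrite leeD2l// lee_fin; lra.
rewrite -lebesgue_measure_oo; last by lra.
rewrite -measureU; first last.
- apply/seteqP; split => // x /= [[x0 hx]]; rewrite in_itv/= => /andP[xl xr].
  have E : x = 1 + (pi * (x - 1)) / pi by rewrite [pi * _]mulrC mulfK ?gt_eqF ?pi_gt0//; ring.
  have xv : pi * (x - 1) < v by rewrite mulrC -ltr_pdivlMr ?pi_gt0//; lra.
  have xv' : v' < pi * (x - 1) by rewrite mulrC -ltr_pdivrMr ?pi_gt0//; lra.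
  move: hx; rewrite E norm_sinc_lobe; [|lra|lra].
  have [|] := andP (rise (pi * (x - 1)) v _ xv vu1); first by lra.
  by rewrite Ev; lra.
- exact: measurable_itv.
- by apply: measurable_superlevel; exact: measurable_sinc.
apply: le_distrib; first exact: measurable_sinc.
  apply: measurableU; last exact: measurable_itv.
  by apply: measurable_superlevel; exact: measurable_sinc.
move=> x [[x0 hx]|]; first by split=> //; exact: lt_trans hx.
rewrite /= in_itv/= => /andP[xl xr].
have v0 : 0 <= v' / pi by rewrite divr_ge0; lra.
have E : x = 1 + (pi * (x - 1)) / pi by rewrite [pi * _]mulrC mulfK ?gt_eqF ?pi_gt0//; ring.
have xv : pi * (x - 1) < v by rewrite mulrC -ltr_pdivlMr ?pi_gt0//; lra.
have xv' : v' < pi * (x - 1) by rewrite mulrC -ltr_pdivrMr ?pi_gt0//; lra.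
split; first by lra.
rewrite E norm_sinc_lobe; [|lra|lra].
have [|] := andP (rise v' (pi * (x - 1)) v'4 xv' _); first by lra.
by rewrite Ev'; lra.
Qed.

Lemma gauss34_ge : (pi : R)^-1 <= gauss (3 / 4 : R).
Proof.
have p0 := @pi_gt31 R; have p1 := @pi_lt32 R.
apply: (@le_trans _ _ ((7 / 10) ^+ 3)).
  by rewrite -[leLHS]mul1r ler_pdivrMr; lra.
have -> : gauss (3 / 4 : R) = expR (- (3 * pi / 32)) ^+ 3.
  by rewrite -expRM_natl /gauss; congr expR; field.
rewrite lerXn2r ?nnegrE ?expR_ge0//; have := expR_ge1Dx (- (3 * pi / 32) : R); lra.
Qed.

(** 3/(5 pi) is the value of sinc at 5/6, where the sine is 1/2. *)
Lemma sinc_head_ge x : 0 < x -> x < 5 / 6 -> 3 / 5 / pi <= `|sinc x|.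
Proof.
move=> x0 x1; have p0 := @pi_gt0 R.
apply: (@norm_sinc_ge_lobe R 0 0 (5 / 6)); rewrite ?add0r ?mulr0 ?mul0r ?sin0//; try lra.
have -> : sin (pi * (5 / 6)) = 1 / 2 :> R.
  by rewrite -sin_pi6 -[in RHS]sin_pisub; congr sin; field.
by rewrite mulrAC divfK ?gt_eqF//; lra.
Qed.

(** At 5/4 there is equality, so concavity leaves only the right end 19/12, where sin(7 pi/12) is
    bounded below by the chord from pi/2 to 2 pi/3. *)
Lemma sinc_mid_ge1 x : 5 / 4 < x -> x < 19 / 12 -> lobe_low <= `|sinc x|.
Proof.
move=> x0 x1; have p0 := @pi_gt0 R; have [l0 l1] := lobe_low_bounds.
have S1 : 93 / 100 <= sin (pi * (7 / 12)) :> R.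
  have S3 : sin (pi * (2 / 3)) = sin (pi / 3) :> R.
    by rewrite -[RHS]sin_pisub; congr sin; field.
  have S2 : sin (pi * (1 / 2)) = 1 :> R by rewrite -[RHS]sin_pihalf; congr sin; field.
  set w := sin (pi / 3) - 1 : R.
  have e z : w * 6 / pi * (pi * z) = w * 6 * z by rewrite mulrA divfK ?gt_eqF.
  have H := @sin_concave_above R (1 - w * 3) (w * 6 / pi) (pi * (1 / 2)) (pi * (2 / 3))
    (pi * (7 / 12)).
  rewrite !e S2 S3 !ler_pM2l// in H.
  have h := @sin_pi3_ge R.
  suff : 1 - w * 3 + w * 6 * (7 / 12) <= sin (pi * (7 / 12)).
    by apply: le_trans; rewrite /w; clear -h; lra.
  apply: H.
  - by apply: mulr_ge0; [exact: ltW|clear; lra].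
  - by clear; lra.
  - by clear; lra.
  - by rewrite ger_pMr//; clear; lra.
  - by clear; lra.
  - by rewrite /w; clear; lra.
apply: (@norm_sinc_ge_lobe R 1 (1 / 4) (7 / 12)); try lra.
have -> : sin (pi * (1 / 4)) = lobe_low * (pi + pi / 4) :> R.
  rewrite /lobe_low /lobe divfK ?gt_eqF//; [by congr sin; field|lra].
lra.
Qed.

(** The constant is 0.707 divided by 7/4: the right end is the binding one, with sin(3 pi/4) >
    0.707. *)
Lemma sinc_mid_ge2 x : 7 / 6 < x -> x < 7 / 4 -> 404 / 1000 / pi <= `|sinc x|.
Proof.
move=> x0 x1; have p0 := @pi_gt0 R; have s4 := @sin_pi4_bounds R.
apply: (@norm_sinc_ge_lobe R 1 (1 / 6) (3 / 4)); try lra; rewrite mulrAC divfK ?gt_eqF//.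
  have -> : pi * (1 / 6) = pi / 6 :> R by field.
  by rewrite sin_pi6; lra.
have -> : sin (pi * (3 / 4)) = sin (pi / 4) :> R by rewrite -[RHS]sin_pisub; congr sin; field.
lra.
Qed.

End crossing.

(** * Low levels and the crossing point *)

Section crossing_point.
Context {R : realType}.
Implicit Types (x y s t u v : R).
Local Notation mu := (@lebesgue_measure R).
Local Notation F := (distrib (@sinc R)).

Lemma gauss_le_decr s s' : 0 <= s -> s <= s' -> gauss s' <= gauss s.
Proof. by move=> s0; rewrite le_eqVlt => /predU1P[->//|/(gauss_decr s0)/ltW]. Qed.

Lemma norm_sin_lobe_ge (n : nat) x : n%:R + 1 / 6 < x -> x < n%:R + 5 / 6 ->
  1 / 2 <= `|sin (pi * x)|.
Proof.
move=> l r; have p0 := @pi_gt0 R.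
have <- : `|sin (pi * (x - n%:R))| = `|sin (pi * x)|.
  by rewrite -(norm_sin_addn _ n); congr (`|sin (pi * _)|); ring.
apply: le_trans (ler_norm _).
suff : 1 / 2 + 0 * (pi * (x - n%:R)) <= sin (pi * (x - n%:R)) by lra.
apply: (@sin_concave_above R _ _ (pi * (1 / 6)) (pi * (5 / 6))).
- by rewrite mulr_ge0// ltW.
- by rewrite ler_pM2l//; lra.
- by rewrite ler_pM2l//; lra.
- by rewrite ger_pMr//; lra.
- have -> : pi * (1 / 6) = pi / 6 :> R by field.
  by rewrite sin_pi6; lra.
- have -> : sin (pi * (5 / 6)) = 1 / 2 :> R.
    by rewrite -sin_pi6 -[in RHS]sin_pisub; congr sin; field.
  by lra.
Qed.

(** The set collects the middle two thirds of the first n unit intervals, where |sin(pi x)| >=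
    sin(pi/6). *)
Lemma lobes_measure (n : nat) : exists A : set R, [/\ measurable A,
  (forall x, A x -> [/\ 0 < x, x < n%:R & 1 / 2 <= `|sin (pi * x)|]) &
  mu A = (2 / 3 * n%:R)%:E].
Proof.
elim: n => [|n [A [mA hA EA]]].
  by exists set0; split=> //; rewrite measure0 mulr0.
have mI : measurable `](n%:R + 1 / 6 : R), (n%:R + 5 / 6)[%classic by exact: measurable_itv.
have n0 : (0 : R) <= n%:R by [].
exists (A `|` `]n%:R + 1 / 6, n%:R + 5 / 6[); split.
- exact: measurableU.
- move=> x [/hA[x0 xn hx]|/=]; rewrite -(@natr1 _ n).
    by split=> //; lra.
  rewrite in_itv/= => /andP[l r]; split; [move: l n0; clear; lra|move: r; clear; lra|exact: (norm_sin_lobe_ge l r)].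
- have := @lebesgue_measure_oo R (n%:R + 1 / 6) (n%:R + 5 / 6) ltac:(lra).
  move=> EI; transitivity (mu A + mu `](n%:R + 1 / 6)%R, (n%:R + 5 / 6)%R[%classic)%E.
    apply: measureU => //.
    by apply/seteqP; split => // x [/hA[_ xn _]]; rewrite /= in_itv/=; lra.
  by rewrite EA EI -EFinD; congr EFin; rewrite -(@natr1 _ n); field.
Qed.

Lemma distrib_sinc_lobes (n : nat) y : (0 < n)%N -> 2 * pi * n%:R * y <= 1 ->
  ((2 / 3 * n%:R)%:E <= F y)%E.
Proof.
move=> n0 yn; have p0 := @pi_gt0 R; have [A [mA hA <-]] := lobes_measure n.
have n0R : (0 : R) < n%:R by rewrite ltr0n.
apply: le_distrib => //; first exact: measurable_sinc.
move=> x /hA[x0 xn hx]; split=> //.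
rewrite norm_sincE// ltr_pdivlMr ?mulr_gt0//.
case: (leP y 0) => y0.
  by apply: (@le_lt_trans _ _ 0); [rewrite mulr_le0_ge0// mulr_ge0// ltW|lra].
have : y * (pi * x) < y * (pi * n%:R) by rewrite ltr_pM2l// ltr_pM2l.
lra.
Qed.

Lemma gauss_7_6 : gauss (7 / 6 : R) * pi < 404 / 1000.
Proof.
have p0 := @pi_gt31 R; have p1 := @pi_lt32 R.
have E : gauss (7 / 6 : R) = (expR (49 * pi / 216) ^+ 3)^-1.
  by rewrite -expRM_natl -expRN /gauss; congr expR; field.
have q : 2 <= expR (49 * pi / 216 : R).
  apply: (@le_trans _ _ (expR (7 / 10))); last by rewrite ler_expR; lra.
  by apply: le_trans (expR_ge_taylor3 _); lra.
have q3 : 8 <= expR (49 * pi / 216 : R) ^+ 3.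
  have -> : 8 = 2 ^+ 3 :> R by ring.
  by rewrite lerXn2r ?nnegrE.
rewrite E mulrC ltr_pdivrMr; lra.
Qed.

Lemma gauss_17_12 : 2 * pi * 3 * gauss (17 / 12 : R) <= 1.
Proof.
have p0 := @pi_gt31 R; have p1 := @pi_lt32 R.
have E : gauss (17 / 12 : R) = (expR (289 * pi / 1152) ^+ 4)^-1.
  by rewrite -expRM_natl -expRN /gauss; congr expR; field.
have q : 43 / 20 <= expR (289 * pi / 1152 : R).
  apply: (@le_trans _ _ (expR (31 / 40))); last by rewrite ler_expR; lra.
  by apply: le_trans (expR_ge_taylor3 _); lra.
have q3 : 20 <= expR (289 * pi / 1152 : R) ^+ 4.
  have q2 : 9 / 2 <= expR (289 * pi / 1152 : R) ^+ 2 by nra.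
  by rewrite -[4%N]/(2 * 2)%N exprM; nra.
rewrite E ler_pdivrMr; lra.
Qed.

(** For s >= 2 the exponent pi s^2/2 is at least 3 s, and a cubic Taylor bound suffices. The factor
    3/2 s + 1 bounds the number of lobes whose middle two thirds have total length at least s. *)
Lemma gauss_large s : 2 <= s -> 2 * pi * (3 / 2 * s + 1) * gauss s <= 1.
Proof.
move=> s2; have p0 := @pi_gt31 R; have p1 := @pi_lt32 R.
have h : gauss s <= (expR (3 * s))^-1.
  rewrite -expRN ler_expR.
  have : 0 <= (pi - 3) * s ^+ 2 by rewrite mulr_ge0 ?sqr_ge0//; lra.
  have : 0 <= s * (s - 2) by rewrite mulr_ge0; lra.
  lra.
have e : 1 + 3 * s + (3 * s) ^+ 2 / 2 + (3 * s) ^+ 3 / 6 <= expR (3 * s).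
  by apply: expR_ge_taylor3; lra.
have k : 2 * pi * (3 / 2 * s + 1) <= expR (3 * s).
  apply: (le_trans _ e); apply: (@le_trans _ _ (64 / 10 * (3 / 2 * s + 1))).
    by rewrite ler_pM2r; lra.
  have : 0 <= s * (s - 2) by rewrite mulr_ge0; lra.
  have : 0 <= s ^+ 2 * (s - 2) by rewrite mulr_ge0 ?sqr_ge0; lra.
  lra.
have k0 : 0 < 2 * pi * (3 / 2 * s + 1) by rewrite !mulr_gt0//; lra.
apply: (@le_trans _ _ (2 * pi * (3 / 2 * s + 1) * (expR (3 * s))^-1)).
  by rewrite ler_pM2l.
by rewrite ler_pdivrMr ?expR_gt0// mul1r.
Qed.

(** The cuts 7/6, 17/12 and 2 are the measures of the pieces exhibited on each range: 5/6 + 1/3,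
    then 5/6 + 7/12, then two thirds of three unit intervals. Beyond 2 the number of lobes grows
    with s. *)
Lemma distrib_sinc_low s : 0 < s -> gauss s < lobe_low -> (s%:E <= F (gauss s))%E.
Proof.
move=> s0 hs; have p0 := @pi_gt31 R; have p00 := @pi_gt0 R.
have [l0 l1] := @lobe_low_bounds R.
have head y : y * pi < 3 / 5 -> forall x : R, 0 < x < 5 / 6 -> y < `|sinc x|.
  move=> yp x /andP[x0 x1]; apply: lt_le_trans (sinc_head_ge x0 x1).
  by rewrite ltr_pdivlMr.
have hs' : gauss s * pi < lobe_low * pi by rewrite ltr_pM2r.
case: (leP s (7 / 6)) => s1.
  apply: (@le_trans _ _ ((5 / 6 - 0) + (19 / 12 - 5 / 4))%:E); first by rewrite lee_fin; lra.
  apply: le_distrib_itv2;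
    [exact: measurable_sinc|clear; lra|clear; lra|clear; lra|clear; lra| |].
    by apply: head; lra.
  by move=> x /andP[? ?]; apply: lt_le_trans hs _; apply: sinc_mid_ge1.
case: (leP s (17 / 12)) => s2.
  have g7 := gauss_7_6.
  have gs : gauss s * pi <= gauss (7 / 6) * pi.
    by rewrite ler_pM2r//; apply: gauss_le_decr; lra.
  apply: (@le_trans _ _ ((5 / 6 - 0) + (7 / 4 - 7 / 6))%:E); first by rewrite lee_fin; lra.
  apply: le_distrib_itv2;
    [exact: measurable_sinc|clear; lra|clear; lra|clear; lra|clear; lra| |].
    by apply: head; lra.
  move=> x /andP[? ?]; apply: lt_le_trans (sinc_mid_ge2 _ _) => //.
  by rewrite ltr_pdivlMr//; lra.
case: (leP s 2) => s3.
  apply: le_trans (@distrib_sinc_lobes 3 (gauss s) isT _); first by rewrite lee_fin; lra.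
  apply: (le_trans _ gauss_17_12); rewrite ler_pM2l ?mulr_gt0//.
  by apply: gauss_le_decr; lra.
pose n := (Num.truncn (3 / 2 * s)).+1.
have /andP[n1 n2] : 3 / 2 * s < n%:R <= 3 / 2 * s + 1.
  have := @Num.Theory.truncn_itv R (3 / 2 * s) ltac:(lra).
  by rewrite /n -(@natr1 _ (Num.truncn _)) lerD2r => /andP[-> ->].
apply: le_trans (@distrib_sinc_lobes n (gauss s) isT _); first by rewrite lee_fin; lra.
apply: le_trans (gauss_large (ltW s3)).
by rewrite ler_pM2r ?gauss_gt0// ler_pM2l ?mulr_gt0.
Qed.

(** The point is the supremum of the s with F(gauss s) <= s and level at least [lobe_low].
    [distrib_sinc_step] carries the inequality leftwards from such an s; beyond the supremum it
    fails by maximality, or the level is below [lobe_low] and [distrib_sinc_low] applies. *)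
Theorem sinc_gauss_crossing : exists s0 : R, [/\ 0 < s0,
  (forall s, 0 < s -> s < s0 -> (F (gauss s) <= s%:E)%E) &
  (forall s, s0 < s -> (s%:E <= F (gauss s))%E)].
Proof.
have p0 := @pi_gt31 R; have p1 := @pi_lt32 R.
have [u1 [u14 u12 peak rise]] := @lobe_rise_bound R.
have [l0 l1] := @lobe_low_bounds R.
have peak_low : lobe_low <= lobe u1 by apply: peak; lra.
have peak_le : lobe u1 <= gauss (3 / 4).
  apply: le_trans gauss34_ge; rewrite /lobe ler_pdivrMr; last lra.
  rewrite mulrDr mulVf ?gt_eqF ?pi_gt0//.
  have : 0 <= pi^-1 * u1 by rewrite mulr_ge0 ?invr_ge0 ?pi_ge0//; lra.
  by have := sin_le1 u1; lra.
pose S := [set s : R | [/\ 0 < s, (F (gauss s) <= s%:E)%E & lobe_low <= gauss s]].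
have S34 : S (3 / 4).
  split; [lra| |exact: le_trans peak_le].
  by apply: (distrib_sinc_le_peak peak) => //; lra.
have ubS : ubound S 2.
  move=> s [s0 _ low]; rewrite leNgt; apply/negP => s2.
  have := gauss_large (ltW s2); apply/negP; rewrite -ltNge.
  have : lobe_low * pi * 8 <= gauss s * pi * (2 * (3 / 2 * s + 1)).
    apply: (@le_trans _ _ (gauss s * pi * 8)); first by rewrite !ler_pM2r//; lra.
    by rewrite ler_pM2l ?mulr_gt0 ?gauss_gt0//; lra.
  lra.
have hS : has_sup S by split; [exists (3 / 4)|exists 2].
exists (sup S); split.
- by apply: (@lt_le_trans _ _ (3 / 4)); [lra|apply: ub_le_sup; [exists 2|]].
- move=> s s0 /(sup_gt (ex_intro _ _ S34))[t [t0 Ft tlow] st].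
  case: (leP (lobe u1) (gauss s)) => hs; first exact: (distrib_sinc_le_peak peak).
  have s34 : 3 / 4 <= s.
    rewrite leNgt; apply/negP => /(gauss_decr (ltW s0)); lra.
  have := le_trans (distrib_sinc_step peak rise u14 u12 s34 st tlow (ltW hs)) Ft.
  rewrite -(@fineK _ (F (gauss s))) ?distrib_sinc_fin ?gauss_gt0//.
  by rewrite -EFinD !lee_fin; lra.
- move=> s ss; have s0 : 0 < s.
    by apply: lt_trans ss; apply: (@lt_le_trans _ _ (3 / 4)); [lra|apply: ub_le_sup; [exists 2|]].
  case: (ltP (gauss s) lobe_low) => hs; first exact: distrib_sinc_low.
  rewrite leNgt; apply/negP => /ltW Fs.
  have : s <= sup S by apply: ub_le_sup; [exists 2|split].
  by rewrite leNgt ss.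
Qed.
End crossing_point.

(** * L^2 norms *)

Section fejer.
Context {R : realType}.
Implicit Types (x y t w c d : R) (n m : nat).
Local Notation mu := (@lebesgue_measure R).

(** Dirichlet kernel 1 + 2 cos x + ... + 2 cos(n x). Primitives are built in parallel, so that
    integrals are read off at the end points. *)
Fixpoint dirichlet n x : R :=
  if n is m.+1 then dirichlet m x + 2 * cos (n%:R * x) else 1.
Fixpoint dirichlet_prim n x : R :=
  if n is m.+1 then dirichlet_prim m x + 2 / n%:R * sin (n%:R * x) else x.
(** Fejer kernel without the usual factor 1/n: it is sin^2(n x/2)/sin^2(x/2) wherever the
    denominator is nonzero. *)
Fixpoint fejer n x : R := if n is m.+1 then fejer m x + dirichlet m x else 0.
Fixpoint fejer_prim n x : R :=
  if n is m.+1 then fejer_prim m x + dirichlet_prim m x else 0.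

Lemma dirichletE n x : dirichlet n x * (1 - cos x) = cos (n%:R * x) - cos (n.+1%:R * x).
Proof.
elim: n => [|n IH]; first by rewrite /= mul0r cos0 !mul1r.
rewrite /= mulrDl IH.
have e1 : n.+1%:R * x = n%:R * x + x :> R by rewrite -(@natr1 _ n); ring.
have e2 : n.+2%:R * x = (n%:R * x + x) + x :> R by rewrite -(@natr1 _ n.+1) -(@natr1 _ n); ring.
rewrite e2 e1; set a := n%:R * x.
have -> : cos a = cos ((a + x) - x) by congr cos; ring.
by rewrite cosB (cosD (a + x) x); ring.
Qed.

Lemma fejerE n x : fejer n x * (1 - cos x) = 1 - cos (n%:R * x).
Proof.
elim: n => [|n IH]; first by rewrite /= !mul0r cos0 subrr.
by rewrite /= mulrDl IH dirichletE; ring.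
Qed.

Lemma sin_natmul_pi n : sin (n%:R * pi) = 0 :> R.
Proof.
elim: n => [|n IH]; first by rewrite mul0r sin0.
by rewrite -(@natr1 _ n) mulrDl mul1r sinDpi IH oppr0.
Qed.

Lemma fejer_prim0 n : fejer_prim n 0 = 0.
Proof.
have h m : dirichlet_prim m 0 = 0.
  by elim: m => //= m ->; rewrite mulr0 sin0 mulr0 addr0.
by elim: n => //= n ->; rewrite h addr0.
Qed.

Lemma fejer_prim_pi n : fejer_prim n pi = n%:R * pi.
Proof.
have h m : dirichlet_prim m pi = pi.
  by elim: m => //= m ->; rewrite sin_natmul_pi mulr0 addr0.
by elim: n => [|n IH]; rewrite /= ?mul0r// IH h -(@natr1 _ n) mulrDl mul1r.
Qed.

Lemma is_derive_dirichlet_prim n w t :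
  is_derive t 1 (fun u => dirichlet_prim n (w * u)) (w * dirichlet n (w * t)).
Proof.
elim: n => [|n IH] /=.
  by apply: is_derive_eq; rewrite /GRing.scale/=; ring.
have D : is_derive t 1 (fun u => sin (n.+1%:R * (w * u)))
    (n.+1%:R * w * cos (n.+1%:R * (w * t))).
  by apply: is_derive_eq; rewrite /GRing.scale/=; ring.
have n0 : (n.+1%:R : R) != 0 by rewrite pnatr_eq0.
have := is_deriveD IH (is_deriveZ (2 / n.+1%:R) D).
move=> /is_derive_eq; apply; rewrite /GRing.scale/= mulrDr; congr (_ + _).
by field.
Qed.

Lemma is_derive_fejer_prim n w t :
  is_derive t 1 (fun u => fejer_prim n (w * u)) (w * fejer n (w * t)).
Proof.
elim: n => [|n IH] /=; first by rewrite mulr0; exact: is_derive_cst.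
by rewrite mulrDr; have := is_deriveD IH (is_derive_dirichlet_prim n w t).
Qed.

Lemma continuous_fejer n w : continuous (fun u => fejer n (w * u)).
Proof.
have cn m : continuous (fun u : R => dirichlet m (w * u)).
  elim: m => [|m IH] /= u; first exact: cvg_cst.
  apply: (@continuousD _ _ _ (fun u => dirichlet m (w * u))); first exact: IH.
  apply: differentiable_continuous; apply/derivable1_diffP.
  by apply: ex_derive; apply: is_derive_eq.
elim: n => [|n IH] /= u; first exact: cvg_cst.
by apply: (@continuousD _ _ _ (fun u => fejer n (w * u)) (fun u => dirichlet n (w * u))); [exact: IH|exact: cn].
Qed.

Lemma integral_is_derive (f G : R -> R) (a b : R) : a < b ->
  (forall x, is_derive x 1 G (f x)) -> continuous f ->
  (\int[mu]_(x in `[a, b]) (f x)%:E = (G b - G a)%:E)%E.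
Proof.
move=> ab dG cf; have cG : continuous G.
  move=> x; apply: differentiable_continuous; apply/derivable1_diffP.
  by have D := dG x; apply: ex_derive.
rewrite EFinB; apply: continuous_FTC2 => //.
- exact: continuous_subspaceT.
- split; last 2 first.
  + exact/cvg_at_right_filter/cG.
  + exact/cvg_at_left_filter/cG.
  by move=> x _; have D := dG x; apply: ex_derive.
- by move=> x _; rewrite derive1E; have D := dG x; rewrite derive_val.
Qed.

(** The right end corresponds to the angle pi, where every sine term of the primitive vanishes and n
    pi remains; the substitution contributes n/(2 pi). *)
Lemma integral_fejer n : (0 < n)%N ->
  (\int[mu]_(x in `[0%R, (n%:R / 2)%R]) (n%:R ^- 2 * fejer n (2 * pi / n%:R * x))%:E = (1 / 2)%:E)%E.
Proof.
move=> n0; have nR : (0 : R) < n%:R by rewrite ltr0n.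
have nN : (n%:R : R) != 0 by rewrite gt_eqF.
pose w : R := 2 * pi / n%:R.
have w0 : 0 < w by rewrite divr_gt0// mulr_gt0// pi_gt0.
pose G u := n%:R ^- 2 / w * fejer_prim n (w * u).
have dG x : is_derive x 1 G (n%:R ^- 2 * fejer n (w * x)).
  have := is_deriveZ (n%:R ^- 2 / w) (is_derive_fejer_prim n w x).
  move=> /is_derive_eq; apply; rewrite /GRing.scale/= mulrA; congr (_ * _).
  by rewrite divfK// gt_eqF.
have cf : continuous (fun x => n%:R ^- 2 * fejer n (w * x)).
  by move=> x; apply: cvgM; [exact: cvg_cst|exact: continuous_fejer].
have -> := integral_is_derive (divr_gt0 nR (ltr0n _ 2)) dG cf.
rewrite /G.
rewrite mulr0 fejer_prim0 mulr0 subr0.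
have -> : w * (n%:R / 2) = pi by rewrite /w mulrA divfK// mulrC mulKf.
rewrite fejer_prim_pi /w; congr EFin; have := @pi_gt0 R; move: (pi : R) => p p0.
have pN : p != 0 by rewrite gt_eqF.
by field; rewrite nN.
Qed.

(** With a = pi x/n in (0, pi/2] the kernel is sin^2(pi x)/sin^2 a, and sin a <= a. *)
Lemma sinc_sqr_le_fejer n x : (0 < n)%N -> 0 < x -> x <= n%:R / 2 ->
  sinc x ^+ 2 <= n%:R ^- 2 * fejer n (2 * pi / n%:R * x).
Proof.
move=> n0 x0 xn; have nR : (0 : R) < n%:R by rewrite ltr0n.
have p0 := @pi_gt0 R.
set a := pi * x / n%:R.
have a0 : 0 < a by rewrite divr_gt0// mulr_gt0.
have ap : a <= pi / 2.
  have : pi * x <= pi * (n%:R / 2) by rewrite ler_pM2l.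
  by rewrite /a ler_pdivrMr//; lra.
have ad : 2 * pi / n%:R * x = a *+ 2 by rewrite /a -mulr_natl; field; rewrite gt_eqF.
have s0 : 0 < sin a by apply: sin_gt0_pi; lra.
have sa : sin a <= a by apply: sin_le_id; exact: ltW.
have na : pi * x = n%:R * a by rewrite /a mulrCA divff ?mulr1// gt_eqF.
have nd : n%:R * (a *+ 2) = (pi * x) *+ 2 by rewrite mulrnAr -na.
have := fejerE n (a *+ 2); rewrite nd !cos_mulr2n !cos2sin2.
rewrite ad; set K := fejer n _ => KE.
have {}KE : K * sin a ^+ 2 = sin (pi * x) ^+ 2.
  move: KE; clear; move: (sin a) (sin _) (K) => s S k.
  have h z : 1 - ((1 - z) *+ 2 - 1) = 2 * z :> R by ring.
  rewrite !h.
  have t2 : (2 : R) != 0 by rewrite pnatr_eq0.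
  by rewrite mulrCA => /(mulfI t2).
have K0 : 0 <= K.
  by rewrite -(pmulr_lge0 _ (exprn_gt0 2 s0)) KE sqr_ge0.
rewrite /sinc expr_div_n -KE na ler_pdivrMr; last by apply: exprn_gt0; exact: mulr_gt0.
have -> : n%:R ^- 2 * K * (n%:R * a) ^+ 2 = K * a ^+ 2.
  by rewrite exprMn mulrA [_ ^- 2 * K]mulrC mulfVK// gt_eqF// exprn_gt0.
by rewrite ler_wpM2l// lerXn2r ?nnegrE//; exact: ltW.
Qed.
End fejer.

(** * Layer cake bound for the squared sinc *)

Section layer_cake.
Context {R : realType}.
Implicit Types (x y t c d : R) (n m : nat).
Local Notation mu := (@lebesgue_measure R).

Lemma integral_sinc_sqr_le n : (0 < n)%N ->
  (\int[mu]_(x in `]0%R, (n%:R / 2)%R]) (sinc x ^+ 2)%:E <= (1 / 2)%:E)%E.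
Proof.
move=> n0; rewrite -(@integral_fejer R n n0).
pose K x : R := n%:R ^- 2 * fejer n (2 * pi / n%:R * x).
have mK : measurable_fun setT K.
  apply: continuous_measurable_fun => x.
  by apply: cvgM; [exact: cvg_cst|exact: continuous_fejer].
have hK x : (`]0, (n%:R / 2)]%classic : set R) x -> sinc x ^+ 2 <= K x.
  by move=> hx; have /andP[x0 xn] : 0 < x <= n%:R / 2 by []; exact: sinc_sqr_le_fejer.
have ms : measurable_fun (`]0, (n%:R / 2)]%classic : set R) (fun x => sinc x ^+ 2).
  apply: measurable_funX; apply: measurable_funS measurable_sinc.
    exact: measurable_itv.
  by move=> x; rewrite /= in_itv/= => /andP[x0 _]; exact/pos_halfE.
rewrite -(integral_itv_obnd_cbnd (f := fun x => (K x)%:E)); last first.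
  by apply/measurable_EFinP; exact: measurable_funTS.
apply: ge0_le_integral => //=.
- by move=> x _; rewrite lee_fin sqr_ge0.
- exact/measurable_EFinP.
- by apply/measurable_EFinP; exact: measurable_funTS.
Qed.

Section truncation.
Variables (D : set R) (v : R -> R).
Hypotheses (mD : measurable D) (mv : measurable_fun D v).

Lemma measurable_excess c : measurable_fun D (EFin \o (fun x => Num.max (v x - c) 0)).
Proof.
apply/measurable_EFinP; apply: measurable_maxr; last exact: measurable_cst.
by apply: measurable_funB => //; exact: measurable_cst.
Qed.

Lemma measurable_level c : measurable (D `&` [set x | c < v x]).
Proof.
have := mv mD (measurable_itv `]c, +oo[); congr (measurable _).
by apply/seteqP; split => x [Dx]/=; rewrite in_itv/= andbT.
Qed.

(** One layer of the layer cake: pointwise, the excess over c plus (c - d) on the set v > c is at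
    most the excess over d. *)
Lemma integral_excess_step c d : d <= c ->
  (\int[mu]_(x in D) (Num.max (v x - c) 0)%:E + (c - d)%:E * mu (D `&` [set x | (c < v x)%R])
     <= \int[mu]_(x in D) (Num.max (v x - d) 0)%:E)%E.
Proof.
move=> dc; set E := D `&` _; have mE : measurable E by exact: measurable_level.
have cd0 : (0 <= (c - d)%:E)%E by rewrite lee_fin subr_ge0.
have -> : ((c - d)%:E * mu E = \int[mu]_(x in D) ((c - d)%:E * (\1_E x)%:E))%E.
  rewrite ge0_integralZl//; last by apply/measurable_EFinP; exact: measurable_indic.
  by rewrite integral_indic// setIidl// => x [].
have mi : measurable_fun D (fun x => (c - d)%:E * (\1_E x)%:E)%E.
  by apply: measurable_funeM; apply/measurable_EFinP; exact: measurable_indic.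
rewrite -ge0_integralD//; first last.
- by move=> x _; rewrite mule_ge0// lee_fin.
- exact: measurable_excess.
- by move=> x _; rewrite lee_fin le_max lexx orbT.
apply: ge0_le_integral => //.
- by move=> x _; rewrite adde_ge0 ?mule_ge0// lee_fin// le_max lexx orbT.
- by apply: emeasurable_funD => //; exact: measurable_excess.
- exact: measurable_excess.
move=> x Dx; rewrite -EFinM -EFinD lee_fin indicE.
have [cv|vc] := ltP c (v x).
  rewrite mem_set; last by split.
  by rewrite mulr1 !maxEle; do 2 case: ifP; lra.
rewrite memNset; last by move=> [_]/=; rewrite ltNge vc.
by rewrite mulr0 !maxEle; do 2 case: ifP; lra.
Qed.

End truncation.

(** By Abel summation the sum consists of layers of height b_m^2 - b_{m+1}^2 and width m d, and a
    last one from b_n^2 down to 0; all of them fit under the squared sinc. *)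
Lemma sum_levels_le (b : nat -> R) (d : R) n : 0 < d ->
  (forall i, 0 < b i) -> (forall i, b i.+1 <= b i) ->
  (forall i, ((i%:R * d)%:E <= distrib (@sinc R) (b i))%E) ->
  \sum_(1 <= i < n.+1) b i ^+ 2 * d <= 1 / 2.
Proof.
move=> d0 b0 bd hb; have p0 := @pi_gt0 R.
(* As |sinc x| <= 1/(pi x), all level sets at heights at least [b n] lie in (0, N/2], where the
   Fejer bound holds. *)
have [N N0 hN] : exists2 N, (0 < N)%N & (pi * b n)^-1 <= N%:R / 2.
  pose z := (pi * b n)^-1 * 2.
  have z0 : 0 <= z by rewrite mulr_ge0// invr_ge0 mulr_ge0 ?pi_ge0// ltW.
  exists (Num.truncn z).+1 => //.
  by have /andP[_ /ltW] := Num.Theory.truncn_itv z0; rewrite /z; lra.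
pose D : set R := `]0, (N%:R / 2)]%classic.
have mD : measurable D by exact: measurable_itv.
pose v x := sinc x ^+ 2 : R.
have mv : measurable_fun D v.
  apply: measurable_funX; apply: measurable_funS measurable_sinc.
    exact: measurable_itv.
  by move=> x; rewrite /D /= in_itv/= => /andP[x0 _]; exact/pos_halfE.
have bm i : (i <= n)%N -> b n <= b i.
  move=> le_in; rewrite -(subnK le_in).
  by elim: (n - i)%N => [|k IH]; [rewrite add0n|exact: le_trans (bd _) IH].
have lev i : (i <= n)%N -> ((i%:R * d)%:E <= mu (D `&` [set x | (b i ^+ 2 < v x)%R]))%E.
  move=> le_in; apply: le_trans (hb i) _; apply: le_measure; rewrite ?inE.
  - by apply: measurable_superlevel; exact: measurable_sinc.
  - exact: measurable_level.
  move=> x [x0 hx]; split.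
    rewrite /D /= in_itv/= x0/=; apply: le_trans hN.
    have : b n < (pi * x)^-1.
      by apply: le_lt_trans (bm _ le_in) (lt_le_trans hx (norm_sinc_le_inv x0)).
    rewrite -[ltRHS]mul1r -[leRHS]mul1r ltr_pdivlMr ?mulr_gt0// ler_pdivlMr ?mulr_gt0//.
    lra.
  by rewrite /v /= -[ltRHS]real_normK ?num_real// ltrXn2r ?nnegrE// ltW.
pose I c := (\int[mu]_(x in D) (Num.max (v x - c) 0)%:E)%E.
have I0 c : (0 <= I c)%E by apply: integral_ge0 => x _; rewrite lee_fin le_max lexx orbT.
have step i c : (i <= n)%N -> c <= b i ^+ 2 ->
    (I (b i ^+ 2)%R + ((b i ^+ 2 - c) * (i%:R * d))%:E <= I c)%E.
  move=> le_in cb; apply: le_trans (integral_excess_step mD mv cb).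
  by rewrite leeD2l// EFinM lee_wpmul2l ?lee_fin ?subr_ge0// lev.
(* Layers are peeled off from the top: the excess over [b m ^+ 2] covers the first m terms, each
   lowered by [b m ^+ 2]. *)
have acc m : (m <= n)%N ->
    ((\sum_(1 <= i < m.+1) (b i ^+ 2 - b m ^+ 2) * d)%:E <= I (b m ^+ 2)%R)%E.
  elim: m => [_|m IH mn]; first by rewrite big_geq//; exact: I0.
  have le2 : b m.+1 ^+ 2 <= b m ^+ 2 by rewrite lerXn2r ?nnegrE// ltW.
  apply: le_trans (step _ _ (ltnW mn) le2).
  apply: le_trans (leeD2r _ (IH (ltnW mn))).
  rewrite -EFinD lee_fin big_nat_recr//= subrr mul0r addr0.
  rewrite le_eqVlt; apply/orP; left; apply/eqP.
  have -> : (b m ^+ 2 - b m.+1 ^+ 2) * (m%:R * d) =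
      \sum_(1 <= i < m.+1) (b m ^+ 2 - b m.+1 ^+ 2) * d.
    by rewrite sumr_const_nat subn1/= -mulr_natl; ring.
  by rewrite -big_split/=; apply: eq_bigr => i _; ring.
have Itot : (I 0%R <= (1 / 2)%:E)%E.
  apply: le_trans (integral_sinc_sqr_le N0); rewrite /I /D le_eqVlt.
  apply/orP; left; apply/eqP; apply: eq_integral => x _.
  by rewrite subr0 max_l// sqr_ge0.
have := le_trans (le_trans (leeD2r _ (acc n (leqnn n))) (step n 0 (leqnn n) (sqr_ge0 _))) Itot.
rewrite -EFinD lee_fin subr0; apply: le_trans.
have -> : b n ^+ 2 * (n%:R * d) = \sum_(1 <= i < n.+1) b n ^+ 2 * d.
  by rewrite sumr_const_nat subn1/= -mulr_natl; ring.
rewrite -big_split/= le_eqVlt; apply/orP; left; apply/eqP.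
by apply: eq_bigr => i _; ring.
Qed.

End layer_cake.

(** * The Gaussian integral and its left Riemann sums *)

Section gauss_sum.
Context {R : realType}.
Implicit Types (x y h M e : R) (n : nat).
Local Notation mu := (@lebesgue_measure R).

Lemma integral_gauss_le_sum h n : 0 < h ->
  (\int[mu]_(x in `[0%R, (n%:R * h)%R]) (gauss_fun x)%:E
    <= (\sum_(i < n) gauss_fun (i%:R * h) * h)%:E)%E.
Proof.
move=> h0; have mg D : measurable_fun D (EFin \o @gauss_fun R).
  by apply/measurable_EFinP/measurable_funTS; exact: measurable_gauss_fun.
elim: n => [|n IH].
  by rewrite mul0r big_ord0 set_itv1 integral_set1.
have nh : n%:R * h <= n.+1%:R * h by rewrite ler_pM2r// ler_nat.
have n0 : 0 <= n%:R * h by rewrite mulr_ge0// ltW.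
have -> : `[0, n.+1%:R * h]%classic = `[0, n%:R * h]%classic `|` `]n%:R * h, n.+1%:R * h]%classic :> set R.
  apply/seteqP; split => x /=; rewrite !in_itv/=.
    by move=> /andP[x0 xn]; case: (leP x (n%:R * h)) => hx; [left|right]; lra.
  by move=> [|]; lra.
rewrite ge0_integral_setU; [|exact: measurable_itv|exact: measurable_itv|exact: mg| |]; first last.
- by apply/disj_set2P/seteqP; split => // x []/=; rewrite !in_itv/=; lra.
- by move=> x _; rewrite lee_fin gauss_fun_ge0.
rewrite big_ord_recr/= EFinD leeD//.
apply: (@le_trans _ _ (\int[mu]_(x in `](n%:R * h)%R, (n.+1%:R * h)%R]) (gauss_fun (n%:R * h))%:E)%E).
  apply: ge0_le_integral; [exact: measurable_itv| |exact: mg|exact: measurable_cst|].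
  - by move=> x _; rewrite lee_fin gauss_fun_ge0.
  - move=> x /=; rewrite in_itv/= => /andP[hx _]; rewrite lee_fin ler_expR lerN2.
    by rewrite lerXn2r ?nnegrE; lra.
rewrite integral_cst//= lebesgue_measure_itv/= lte_fin ltr_pM2r// ltr_nat ltnSn.
by rewrite -EFinB -EFinM lee_fin -(@natr1 _ n); lra.
Qed.

Lemma integral_gauss_tail e : 0 < e -> exists M0, forall M, M0 <= M ->
  ((Num.sqrt pi / 2 - e)%:E <= \int[mu]_(x in `[0%R, M]) (gauss_fun x)%:E)%E.
Proof.
move=> e0.
have mg D : measurable_fun D (EFin \o @gauss_fun R).
  by apply/measurable_EFinP/measurable_funTS; exact: measurable_gauss_fun.
have := @integral0y_gauss R.
rewrite ge0_integral_ereal_sup//; first last.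
- exact: measurable_gauss_fun.
- exact: gauss_fun_ge0.
move=> Eg; have : ((Num.sqrt pi / 2 - e)%:E < (Num.sqrt pi / 2)%:E)%E by rewrite lte_fin; lra.
rewrite -Eg => /ereal_sup_gt[_ [n _ <-] /ltW hn].
exists n.+1%:R => M nM; apply: le_trans hn _; apply: ge0_subset_integral; [exact: measurable_itv|exact: measurable_itv|exact: mg| |].
- by move=> x _; rewrite lee_fin gauss_fun_ge0.
- by move=> x /=; rewrite !in_itv/= => /andP[x0 xn]; apply/andP; split=> //; exact: le_trans xn nM.
Qed.
End gauss_sum.

(** * Majorization of step functions *)

Section step_functions.
Context {R : realType}.
Implicit Types (x t d : R) (n : nat).
Local Notation mu := (@lebesgue_measure R).

(** Closed on the right, so that the first n cells tile ]0, n d], the support of the truncated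
    sinc. *)
Definition cell d (i : nat) : set R := `](i%:R * d), (i.+1%:R * d)]%classic.

Definition step d n (v : 'I_n -> R) x : R := \sum_(i < n) v i * \1_(cell d i) x.

Lemma cellP d i x : cell d i x <-> i%:R * d < x <= i.+1%:R * d.
Proof. by rewrite /cell /= in_itv/=. Qed.

Lemma measurable_cell d i : measurable (cell d i).
Proof. exact: measurable_itv. Qed.

Lemma lebesgue_measure_cell d i : 0 < d -> mu (cell d i) = d%:E.
Proof.
move=> d0; rewrite lebesgue_measure_itv/= lte_fin ltr_pM2r// ltr_nat ltnSn.
by rewrite -EFinB -(@natr1 _ i) mulrDl mul1r; congr EFin; ring.
Qed.

Lemma cell_inj d i j x : 0 < d -> cell d i x -> cell d j x -> i = j.
Proof.
move=> d0; wlog ij : i j / (i <= j)%N => [H hi hj|].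
  by case/orP: (leq_total i j) => ?; [apply: H|symmetry; apply: H].
move=> /cellP/andP[_ xi] /cellP/andP[xj _]; apply/eqP; rewrite eqn_leq ij/=.
by have := lt_le_trans xj xi; rewrite ltr_pM2r// ltr_nat.
Qed.

Lemma step_in d n (v : 'I_n -> R) (i : 'I_n) x : 0 < d -> cell d i x -> step d v x = v i.
Proof.
move=> d0 ci; rewrite /step (bigD1 i)//= big1 ?addr0.
  by rewrite indicE mem_set// mulr1.
move=> j ji; rewrite indicE memNset ?mulr0// => cj.
by move/eqP: ji; apply; apply: val_inj; exact: (cell_inj d0 cj ci).
Qed.

Lemma step_out d n (v : 'I_n -> R) x : (forall i : 'I_n, ~ cell d i x) -> step d v x = 0.
Proof.
by move=> h; rewrite /step big1// => i _; rewrite indicE memNset ?mulr0//; exact: h.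
Qed.

(** Evaluation at [x] is one coordinate or zero, uniformly in [v]; this transfers coordinatewise
    relations to step functions. *)
Lemma stepP d n x : 0 < d ->
  (exists i : 'I_n, forall v : 'I_n -> R, step d v x = v i) \/
  (forall v : 'I_n -> R, step d v x = 0).
Proof.
move=> d0; have [[i ci]|h] := pselect (exists i : 'I_n, cell d i x).
  by left; exists i => v; exact: step_in.
by right => v; apply: step_out => i ci; apply: h; exists i.
Qed.

Lemma measurable_step d n (v : 'I_n -> R) (D : set R) : measurable_fun D (step d v).
Proof.
apply: measurable_funTS; rewrite /step; apply: measurable_sum => i.
apply: measurable_funM; first exact: measurable_cst.
by apply: measurable_indic; exact: measurable_cell.
Qed.

Lemma distrib_step d n (v : 'I_n -> R) t : 0 < d -> 0 <= t ->
  distrib (step d v) t = (\sum_(i < n) (if t < `|v i| then d else 0))%:E.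
Proof.
move=> d0 t0; pose F (i : 'I_n) : set R := if t < `|v i| then cell d i else set0.
have mF i : measurable (F i) by rewrite /F; case: ifP => _; [exact: measurable_cell|].
have -> : distrib (step d v) t = mu (\big[setU/set0]_(i < n) F i).
  rewrite /distrib; congr (mu _); rewrite -bigcup_seq; apply/seteqP; split => x /=.
    move=> [x0 tx]; have [[i ci]|h] := pselect (exists i : 'I_n, cell d i x).
      exists i; first by rewrite /= mem_index_enum.
      by rewrite /F -(step_in v d0 ci) tx.
    by move: tx; rewrite step_out ?normr0 ?ltNge ?t0// => i ci; apply: h; exists i.
  move=> [i _]; rewrite /F; case: ifP => // tv ci; split.
    by move/cellP: ci => /andP[ci _]; apply: le_lt_trans ci; rewrite mulr_ge0// ltW.
  by rewrite (step_in v d0 ci).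
rewrite measure_bigsetU_ord//; last first.
  move=> i j _ _ [x [Fi Fj]]; apply: val_inj.
  have cF k : F k x -> cell d k x by rewrite /F; case: ifP.
  exact: (cell_inj d0 (cF _ Fi) (cF _ Fj)).
rewrite -sumEFin; apply: eq_bigr => i _; rewrite /F; case: ifP => _.
  exact: lebesgue_measure_cell.
exact: measure0.
Qed.

Lemma distrib_step_perm d n (v : 'I_n -> R) (s : {perm 'I_n}) t : 0 < d -> 0 <= t ->
  distrib (step d (v \o s)) t = distrib (step d v) t.
Proof.
move=> d0 t0; rewrite !distrib_step//; congr EFin.
by rewrite [RHS](reindex_inj (@perm_inj _ s)).
Qed.
End step_functions.

(** * T-transforms of squares in a 2-convex space *)

Section majorization.
Context {R : realType}.
Variables (N : (R -> R) -> \bar R).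
Hypotheses (riN : ri_space N) (cvxN : exact_2_convex N).
Implicit Types (x t d c C : R) (n : nat) (f g : R -> R).

Lemma ri_distrib f g : inX N f -> measurable_fun (@pos_half R) g ->
  (forall t, 0 < t -> (distrib g t <= distrib f t)%E) -> (N g <= N f)%E.
Proof.
move=> Xf mg fg; apply: (ri_rearr riN) => // s s0.
apply: ereal_inf_le_tmp => _ [t [t0 ft] <-]; exists t => //; split=> //.
exact: le_trans (fg _ t0) ft.
Qed.

Variables (n : nat) (d : R).
Hypothesis d0 : 0 < d.

(** Exact 2-convexity for the two functions scaled by the roots of s and 1 - s: a ball of the norm
    is convex in the squares. *)
Lemma ri_step_convex (v w : 'I_n -> R) (s C : R) : 0 <= s -> s <= 1 ->
  (N (step d v) <= C%:E)%E -> (N (step d w) <= C%:E)%E ->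
  (N (step d (fun i => Num.sqrt (s * v i ^+ 2 + (1 - s) * w i ^+ 2))) <= C%:E)%E.
Proof.
move=> s0 s1 hv hw; have Xv : inX N (step d v) by exact: le_lt_trans hv (ltry _).
have Xw : inX N (step d w) by exact: le_lt_trans hw (ltry _).
pose r := Num.sqrt s; pose q := Num.sqrt (1 - s).
pose f (k : 'I_2) x := if k == ord0 then r * step d v x else q * step d w x.
have N0 : N (f ord0) = (r%:E * N (step d v))%E.
  by rewrite /f eqxx (ri_homog riN)// ger0_norm// sqrtr_ge0.
have N1 : N (f (lift ord0 ord0)) = (q%:E * N (step d w))%E.
  by rewrite /f/= (ri_homog riN)// ger0_norm// sqrtr_ge0.
have fv : N (step d v) \is a fin_num by rewrite ge0_fin_numE// (ri_ge0 riN).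
have fw : N (step d w) \is a fin_num by rewrite ge0_fin_numE// (ri_ge0 riN).
have Xf k : inX N (f k).
  rewrite /inX; case: (unliftP ord0 k) => [j ->|->].
    by rewrite (ord1 j) N1 -(fineK fw) -EFinM ltry.
  by rewrite N0 -(fineK fv) -EFinM ltry.
have := cvxN Xf; rewrite big_ord_recl big_ord1 N0 N1.
rewrite !fineM// !exprMn !sqr_sqrtr ?subr_ge0// => h.
have -> : step d (fun i => Num.sqrt (s * v i ^+ 2 + (1 - s) * w i ^+ 2)) =
    (fun x => Num.sqrt (\sum_(k < 2) f k x ^+ 2)).
  apply/funext => x; rewrite big_ord_recl big_ord1 /f eqxx/= !exprMn !sqr_sqrtr ?subr_ge0//.
  have [[i E]|E] := stepP n x d0; rewrite !E//.
  by rewrite expr0n/= !mulr0 addr0 sqrtr0.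
apply: (le_trans h); rewrite lee_fin.
have C0 : 0 <= C by rewrite -lee_fin; apply: le_trans hv; exact: (ri_ge0 riN).
rewrite -(ger0_norm C0) -sqrtr_sqr ler_wsqrtr//.
have lv : fine (N (step d v)) ^+ 2 <= C ^+ 2.
  by rewrite lerXn2r ?nnegrE// ?fine_ge0 ?(ri_ge0 riN)// -lee_fin fineK.
have lw : fine (N (step d w)) ^+ 2 <= C ^+ 2.
  by rewrite lerXn2r ?nnegrE// ?fine_ge0 ?(ri_ge0 riN)// -lee_fin fineK.
have := ler_wpM2l s0 lv; have : 0 <= 1 - s by lra.
by move=> t0; have := ler_wpM2l t0 lw; lra.
Qed.

Definition step_sqrt (A : 'I_n -> R) := step d (fun i => Num.sqrt (A i)).

Lemma ri_step_le (A B : 'I_n -> R) : (forall i, A i <= B i) ->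
  inX N (step_sqrt B) -> (N (step_sqrt A) <= N (step_sqrt B))%E.
Proof.
move=> AB XB; apply: (ri_lattice riN) => //; first exact: measurable_step.
move=> x x0; rewrite /step_sqrt; have [[i E]|E] := stepP n x d0; rewrite !E//.
by rewrite !ger0_norm ?sqrtr_ge0// ler_wsqrtr.
Qed.

(* A T-transform of B is a convex combination of B and B with i and j swapped. *)
Lemma ri_T_transform (B : 'I_n -> R) (i j : 'I_n) (e C : R) :
  (forall k, 0 <= B k) -> 0 < e -> e <= B i - B j ->
  (N (step_sqrt B) <= C%:E)%E ->
  (N (step_sqrt (fun k => (if k == i then B i - e else if k == j then B j + e else B k)%R))
     <= C%:E)%E.
Proof.
move=> B0 e0 eB NB; pose s := 1 - e / (B i - B j).
have Bij : 0 < B i - B j by lra.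
have se : e / (B i - B j) <= 1 by rewrite ler_pdivrMr// mul1r.
have se0 : 0 <= e / (B i - B j) by rewrite divr_ge0// ltW.
have XB : inX N (step_sqrt B) by exact: le_lt_trans NB (ltry _).
have swap : (N (step d ((fun k => Num.sqrt (B k)) \o tperm i j)) <= C%:E)%E.
  apply: le_trans NB; apply: ri_distrib => //; first exact: measurable_step.
  by move=> t t0; rewrite distrib_step_perm// ltW.
have s0 : 0 <= s by rewrite /s; lra.
have s1 : s <= 1 by rewrite /s; lra.
apply: le_trans (ri_step_convex s0 s1 NB swap); rewrite /s.
rewrite le_eqVlt; apply/orP; left; apply/eqP; congr (N (step d _)).
apply/funext => k /=; congr Num.sqrt; rewrite !sqr_sqrtr//.
have E : e / (B i - B j) * (B i - B j) = e by rewrite divfK// gt_eqF.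
move: E; set r := e / _ => E.
case: eqP => [->|/eqP ki]; first by rewrite tpermL; lra.
case: eqP => [->|/eqP kj]; first by rewrite tpermR; lra.
by rewrite tpermD 1?eq_sym//; lra.
Qed.

(** Induction on the number of indices where A and B differ. If A > B at j, the sums give some i
    with A < B; moving mass from i to j settles one of the two. The threshold replaces sorted
    partial sums: it forces B j <= c <= A i < B i, so each move is a T-transform, and the pattern
    persists. *)
Lemma ri_majorization (A B : 'I_n -> R) (c C : R) :
  (forall i, 0 <= A i) -> (forall i, 0 <= B i) ->
  (forall i, c <= A i <= B i \/ B i <= A i <= c) ->
  \sum_i A i <= \sum_i B i ->
  (N (step_sqrt B) <= C%:E)%E -> (N (step_sqrt A) <= C%:E)%E.
Proof.
move=> A0; have [m] := ubnP #|[pred i | A i != B i]|.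
elim: m B => // m IH B mB B0 thr sAB NB.
have XB : inX N (step_sqrt B) by exact: le_lt_trans NB (ltry _).
have [AB|/existsNP[j /negP]] := pselect (forall i, A i <= B i).
  by apply: le_trans NB; exact: ri_step_le.
rewrite -ltNge => BAj.
have [i ABi] : exists i, A i < B i.
  apply: contrapT => /forallNP h.
  have le i : B i <= A i by rewrite leNgt; apply/negP; exact: h.
  have : \sum_i B i < \sum_i A i.
    rewrite (bigD1 j)//= [ltRHS](bigD1 j)//= ltr_leD//.
    by apply: ler_sum => k _; exact: le.
  by rewrite ltNge sAB.
have [/andP[cAi _]|] := thr i; last by move=> /andP[]; rewrite leNgt ABi.
have [|/andP[_ Ajc]] := thr j; first by move=> /andP[_]; rewrite leNgt BAj.
have ij : i != j by apply: contraTN ABi => /eqP ->; rewrite -leNgt ltW.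
(* The largest transfer that overshoots at neither index. *)
pose e := Num.min (B i - A i) (A j - B j).
have e0 : 0 < e by rewrite lt_min !subr_gt0 ABi.
have e1 : e <= B i - A i by rewrite ge_min lexx.
have e2 : e <= A j - B j by rewrite ge_min lexx orbT.
pose B' k := if k == i then B i - e else if k == j then B j + e else B k.
have B'i : B' i = B i - e by rewrite /B' eqxx.
have B'j : B' j = B j + e by rewrite /B' eq_sym (negbTE ij) eqxx.
have B'k k : k != i -> k != j -> B' k = B k by rewrite /B' => /negbTE -> /negbTE ->.
have := A0 i; have := B0 j => Bj0 Ai0.
apply: (IH B').
- rewrite -ltnS; apply: leq_trans mB; rewrite ltnS; apply: proper_card.
  apply/properP; split.
    apply/fintype.subsetP => k; rewrite !inE.
    have [->|ki] := eqVneq k i; first by move=> _; rewrite lt_eqF.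
    have [->|kj] := eqVneq k j; first by move=> _; rewrite gt_eqF.
    by rewrite B'k.
  have [E|E] : e = B i - A i \/ e = A j - B j.
    by rewrite /e; case: (leP (B i - A i) (A j - B j)); [left|right].
  + exists i; first by rewrite inE lt_eqF.
    by rewrite inE B'i E; apply/negPn/eqP; ring.
  + exists j; first by rewrite inE gt_eqF.
    by rewrite inE B'j E; apply/negPn/eqP; ring.
- move=> k; have [->|ki] := eqVneq k i; first by rewrite B'i; lra.
  have [->|kj] := eqVneq k j; first by rewrite B'j; lra.
  by rewrite B'k.
- move=> k; have [->|ki] := eqVneq k i; first by left; rewrite B'i; lra.
  have [->|kj] := eqVneq k j; first by right; rewrite B'j; lra.
  by rewrite B'k.
- rewrite (le_trans sAB)// (bigD1 i)//= (bigD1 j) 1?eq_sym//=.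
  rewrite [leRHS](bigD1 i)//= [X in _ <= _ + X](bigD1 j) 1?eq_sym//= B'i B'j.
  rewrite [X in _ <= _ + (_ + X)](eq_bigr B).
    by move: (\sum_(_ | _) _) => S; lra.
  by move=> k /andP[ki kj]; rewrite B'k.
- by apply: ri_T_transform => //; lra.
Qed.

End majorization.

(** * The comparison in X *)

Section tail.
Context {R : realType}.
Variables (N : (R -> R) -> \bar R).
Hypotheses (riN : ri_space N) (cvxN : exact_2_convex N) (XG : inX N (@gauss R)).
Implicit Types (x t d c M : R) (m n k : nat) (f g : R -> R).
Local Notation mu := (@lebesgue_measure R).

Definition sinc_trunc M x := sinc x * \1_(`]0, M]%classic : set R) x.

Lemma sinc_trunc_in M x : 0 < x -> x <= M -> sinc_trunc M x = sinc x.
Proof.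
by move=> x0 xM; rewrite /sinc_trunc indicE mem_set ?mulr1//= in_itv/= x0.
Qed.

Lemma sinc_trunc_out M x : M < x -> sinc_trunc M x = 0.
Proof.
move=> xM; rewrite /sinc_trunc indicE memNset ?mulr0//= in_itv/= => /andP[_].
by rewrite leNgt xM.
Qed.

Lemma measurable_sinc_trunc M : measurable_fun (@pos_half R) (sinc_trunc M).
Proof.
apply: measurable_funM; first exact: measurable_sinc.
by apply: measurable_indic; exact: measurable_itv.
Qed.

Lemma inX_scale c f : inX N f -> inX N (fun x => c * f x).
Proof.
move=> Xf; rewrite /inX (ri_homog riN)//.
have ff : N f \is a fin_num by rewrite ge0_fin_numE// (ri_ge0 riN).
by rewrite -(fineK ff) -EFinM ltry.
Qed.

(** The Gaussian is at least gauss M > 0 on (0, M], so a multiple of it dominates. *)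
Lemma inX_bounded f c M : measurable_fun (@pos_half R) f ->
  (forall x, 0 < x -> `|f x| <= c) -> (forall x, M < x -> f x = 0) -> inX N f.
Proof.
move=> mf fc fM; have c0 : 0 <= c.
  by apply: le_trans (fc 1 ltr01).
have [M0|M0] := leP 0 M; last first.
  apply: le_lt_trans (XG); apply: (ri_lattice riN) => // x x0.
  by rewrite fM ?normr0//; lra.
apply: le_lt_trans (inX_scale (c / gauss M) XG).
apply: (ri_lattice riN) => //; first exact: inX_scale.
move=> x x0; have [xM|xM] := leP x M; last by rewrite fM// normr0.
apply: le_trans (fc _ x0) _; rewrite ger0_norm; last first.
  by rewrite mulr_ge0 ?divr_ge0// ltW// gauss_gt0.
rewrite mulrAC ler_pdivlMr ?gauss_gt0// ler_wpM2l//.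
by apply: gauss_le_decr => //; exact: ltW.
Qed.

Lemma inX_sinc_trunc M : inX N (sinc_trunc M).
Proof.
apply: (@inX_bounded _ 1 M); [exact: measurable_sinc_trunc| |exact: sinc_trunc_out].
move=> x x0; have [xM|xM] := leP x M.
  by rewrite sinc_trunc_in// norm_sinc_le1.
by rewrite sinc_trunc_out// normr0.
Qed.

Lemma distrib_cell1 k t : 0 <= t -> distrib (\1_(cell 1 k) : R -> R) t = (if t < 1 then 1 else 0)%:E.
Proof.
move=> t0; case: ifP => t1.
  rewrite /distrib -(lebesgue_measure_cell k (@ltr01 R)); congr (mu _).
  apply/seteqP; split => x /=.
    move=> [x0]; rewrite indicE; case: (boolP (x \in cell 1 k)); first by rewrite inE.
    by rewrite normr0 ltNge t0.
  move=> cx; split; last by rewrite indicE mem_set// normr1.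
  by move/cellP: cx => /andP[cx _]; apply: le_lt_trans cx; rewrite mulr_ge0.
rewrite /distrib (_ : [set _ | _] = set0) ?measure0//.
apply/seteqP; split => x //= [x0]; rewrite indicE.
by case: (x \in _); rewrite ?normr1 ?normr0 ?t1// ltNge t0.
Qed.

Lemma inX_cell1 k : inX N (\1_(cell 1 k)).
Proof.
apply: (@inX_bounded _ 1 (k.+1%:R)).
- by apply: measurable_indic; exact: measurable_cell.
- by move=> x _; rewrite indicE; case: (x \in _); rewrite ?normr1 ?normr0.
- move=> x kx; rewrite indicE memNset// => /cellP/andP[_].
  by rewrite mulr1 leNgt kx.
Qed.

Let K := fine (N (\1_(cell 1 0))).

(** Unit cells are equimeasurable, so one constant serves all translates. *)
Lemma norm_cell1_le k : (N (\1_(cell 1 k)) <= K%:E)%E.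
Proof.
rewrite /K fineK; last by rewrite ge0_fin_numE ?(ri_ge0 riN)//; exact: inX_cell1.
apply: (ri_distrib riN); first exact: inX_cell1.
  by apply: measurable_indic; exact: measurable_cell.
by move=> t t0; rewrite !distrib_cell1// ltW.
Qed.

Lemma sum_inv_sqr_le m n : (1 < m)%N ->
  \sum_(k < n) ((m + k)%:R ^- 2 : R) <= m.-1%:R^-1 - (m + n).-1%:R^-1.
Proof.
case: m => [//|[//|m]] _; elim: n => [|n IH].
  by rewrite big_ord0 addn0 subrr.
rewrite big_ord_recr/= addnS !addSn /=; move: IH; rewrite !addSn/=.
set S := \sum_(_ < n) _; set j := (m + n)%N => IH.
have j0 : 0 < j.+1%:R :> R by [].
have h : (j.+2%:R : R) ^- 2 <= j.+1%:R^-1 - j.+2%:R^-1.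
  rewrite -(@natr1 _ j.+1); move: (j.+1%:R : R) j0 => z z0.
  have -> : z^-1 - (z + 1)^-1 = (z * (z + 1))^-1.
    by field; apply/andP; split; rewrite gt_eqF//; lra.
  have z1 : 0 < z * (z + 1) by rewrite mulr_gt0//; lra.
  have z2 : 0 < (z + 1) ^+ 2 by rewrite exprn_gt0//; lra.
  by rewrite lef_pV2 ?posrE// expr2 ler_pM2r; lra.
by apply: le_trans (lerD IH h) _; rewrite addrA subrK.
Qed.

(** On the unit cell of index m + k, |sinc| is at most 1/(pi (m + k)). Exact 2-convexity makes these
    contributions add up in l^2, where they converge; the triangle inequality would give a divergent
    harmonic sum. *)
Lemma sinc_block_le m n : (1 < m)%N -> (m <= n)%N ->
  (N (fun x => (sinc_trunc n%:R x - sinc_trunc m%:R x)%R) <= (K * Num.sqrt (m.-1%:R^-1))%:E)%E.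
Proof.
move=> m1 mn; have p1 : 1 <= pi :> R by have := @pi_ge2 R; lra.
pose f (k : 'I_(n - m)) x : R := (pi * (m + k)%:R)^-1 * \1_(cell 1 (m + k)) x.
have c0 (k : 'I_(n - m)) : 0 < (m + k)%:R :> R by rewrite ltr0n addn_gt0 (ltn_trans _ m1).
have K0 : 0 <= K by apply: fine_ge0; exact: (ri_ge0 riN).
have Xf (k : 'I_(n - m)) : inX N (f k) by apply: inX_scale; exact: inX_cell1.
have Nf (k : 'I_(n - m)) : fine (N (f k)) ^+ 2 <= K ^+ 2 * (m + k)%:R ^- 2.
  have -> : N (f k) = ((pi * (m + k)%:R)^-1%:E * N (\1_(cell 1 (m + k))))%E.
    by rewrite (ri_homog riN) ?ger0_norm//; [rewrite invr_ge0 mulr_ge0//; lra|exact: inX_cell1].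
  have fi : N (\1_(cell 1 (m + k))) \is a fin_num.
    by rewrite ge0_fin_numE ?(ri_ge0 riN)//; exact: inX_cell1.
  rewrite fineM//= -exprVn -exprMn.
  set y := fine (N (\1_(cell 1 (m + k)))).
  have y0 : 0 <= y by apply: fine_ge0; exact: (ri_ge0 riN).
  have yK : y <= K by rewrite -lee_fin /y fineK// norm_cell1_le.
  have i0 : 0 <= (pi * (m + k)%:R)^-1 :> R by rewrite invr_ge0 mulr_ge0//; lra.
  have i1 : (pi * (m + k)%:R)^-1 <= (m + k)%:R^-1 :> R.
    have h : 0 < pi * (m + k)%:R :> R by rewrite mulr_gt0//; lra.
    by rewrite lef_pV2 ?posrE// ler_peMl// ltW.
  have h1 : (pi * (m + k)%:R)^-1 * y <= K * (m + k)%:R^-1 by rewrite mulrC ler_pM.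
  have h0 : 0 <= (pi * (m + k)%:R)^-1 * y by rewrite mulr_ge0.
  by rewrite lerXn2r ?nnegrE//; exact: le_trans h1.
have := cvxN Xf; set Q := fun x : R => _ => NQ.
have XQ : inX N Q by exact: le_lt_trans NQ (ltry _).
apply: (@le_trans _ _ (N Q)); last first.
  apply: (le_trans NQ); rewrite lee_fin -[X in X * _](ger0_norm K0) -sqrtr_sqr -sqrtrM ?sqr_ge0//.
  rewrite ler_wsqrtr//; apply: (@le_trans _ _ (\sum_(k < n - m) K ^+ 2 * (m + k)%:R ^- 2)).
    by apply: ler_sum => k _; exact: Nf.
  rewrite -mulr_sumr ler_wpM2l ?sqr_ge0//; apply: le_trans (sum_inv_sqr_le _ m1) _.
  by rewrite gerBl invr_ge0.
apply: (ri_lattice riN) => //.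
  by apply: measurable_funB; exact: measurable_sinc_trunc.
move=> x x0; rewrite [leRHS]ger0_norm ?sqrtr_ge0//.
have mnR : m%:R <= n%:R :> R by rewrite ler_nat.
have [xm|xm] := leP x m%:R.
  by rewrite !sinc_trunc_in ?subrr ?normr0 ?sqrtr_ge0//; lra.
have [xn|xn] := ltP n%:R x.
  by rewrite !sinc_trunc_out ?subrr ?normr0 ?sqrtr_ge0//; lra.
rewrite sinc_trunc_in// (sinc_trunc_out xm) subr0.
have [k hk] : exists k : 'I_(n - m), cell 1 (m + k) x.
  have [i ix] : exists i : nat, i%:R < x <= i.+1%:R.
    (* Cells being closed on the right, an integer [x] belongs to the cell before its truncation. *)
    exists (Num.truncn x - (x == (Num.truncn x)%:R))%N.
    have /andP[t1 t2] := Num.Theory.truncn_itv (ltW x0).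
    have [E|E] := eqVneq x (Num.truncn x)%:R.
      rewrite subn1; have t0 : (0 < Num.truncn x)%N by rewrite -(ltr0n R) -E.
      by rewrite prednK// -E lexx andbT {2}E ltr_nat prednK.
    by rewrite subn0 (ltW t2) andbT lt_neqAle t1 eq_sym E.
  case/andP: ix => ix1 ix2.
  have mi : (m <= i)%N by have := lt_le_trans xm ix2; rewrite ltr_nat.
  have ni : (i < n)%N by have := lt_le_trans ix1 xn; rewrite ltr_nat.
  have im : (i - m < n - m)%N by rewrite ltn_sub2r// (leq_ltn_trans mi).
  by exists (Ordinal im) => /=; apply/cellP; rewrite subnKC// !mulr1 ix1.
rewrite /Q -[leLHS]ger0_norm// -sqrtr_sqr ler_wsqrtr//.
rewrite (bigD1 k)//=; apply: (@le_trans _ _ (f k x ^+ 2)); last first.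
  by rewrite lerDl sumr_ge0// => i _; exact: sqr_ge0.
have p0 := @pi_gt0 R.
have kx : (m + k)%:R <= x by move/cellP: hk; rewrite mulr1 => /andP[/ltW].
have pk0 : 0 < pi * (m + k)%:R :> R by rewrite mulr_gt0.
have px0 : 0 < pi * x by rewrite mulr_gt0.
rewrite /f indicE mem_set// mulr1 lerXn2r ?nnegrE ?invr_ge0 ?(ltW pk0)//.
apply: le_trans (norm_sinc_le_inv x0) _.
by rewrite lef_pV2 ?posrE// ler_pM2l.
Qed.

Lemma inv_sqrt_small c e : 0 <= c -> 0 < e -> exists m, (1 < m)%N /\
  forall n, (m <= n)%N -> c * Num.sqrt (n.-1%:R^-1) < e.
Proof.
move=> c0 e0; pose z := (c / e) ^+ 2 + 1; have z0 : 0 <= z by rewrite addr_ge0 ?sqr_ge0.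
exists (Num.truncn z).+2; split=> // n mn.
have zn : (c / e) ^+ 2 < n.-1%:R.
  have /andP[_ h] := Num.Theory.truncn_itv z0.
  apply: (@lt_le_trans _ _ (Num.truncn z).+1%:R); first by apply: lt_trans h; rewrite /z; lra.
  by rewrite ler_nat; case: n mn.
have n0 : 0 < n.-1%:R :> R by apply: le_lt_trans zn; exact: sqr_ge0.
have ce : 0 <= c / e by rewrite divr_ge0// ltW.
have h : c / e < Num.sqrt (n.-1%:R).
  by rewrite -(ger0_norm ce) -sqrtr_sqr ltr_sqrt.
rewrite sqrtrV ?ltW//; rewrite ltr_pdivrMr ?sqrtr_gt0//.
by move: h; rewrite ltr_pdivrMr// mulrC.
Qed.

Lemma N_sub_sym f g : inX N (fun x => f x - g x) -> N (fun x => f x - g x) = N (fun x => g x - f x).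
Proof.
move=> X; have -> : (fun x => g x - f x) = (fun x => -1 * (f x - g x)).
  by apply/funext => x; ring.
by rewrite (ri_homog riN)// normrN1 mul1e.
Qed.

Lemma sinc_trunc_cauchy e : 0 < e -> exists n0 : nat, forall m n : nat,
  (n0 <= m)%N -> (n0 <= n)%N ->
  (N (fun x => (sinc_trunc m%:R x - sinc_trunc n%:R x)%R) < e%:E)%E.
Proof.
move=> e0; have K0 : 0 <= K by apply: fine_ge0; exact: (ri_ge0 riN).
have [n0 [n01 hn0]] := inv_sqrt_small K0 e0.
have ord m n : (n0 <= m)%N -> (m <= n)%N ->
    (N (fun x => (sinc_trunc n%:R x - sinc_trunc m%:R x)%R) < e%:E)%E.
  move=> nm mn; apply: le_lt_trans (sinc_block_le (leq_trans n01 nm) mn) _.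
  by rewrite lte_fin hn0.
exists n0 => m n nm nn; case/orP: (leq_total n m) => h; first exact: ord.
have := ord _ _ nm h => lt; rewrite N_sub_sym//; last first.
  rewrite /inX.
  have -> : (fun x => sinc_trunc m%:R x - sinc_trunc n%:R x) =
     (fun x => -1 * (sinc_trunc n%:R x - sinc_trunc m%:R x)).
    by apply/funext => x; ring.
  by apply: inX_scale; exact: lt_trans lt (ltry _).
Qed.

(** Completeness gives a limit [h] of the truncations, and h = sinc almost everywhere because their
    difference on each (0, m] has norm 0. Changing sinc on a null set leaves distribution functions
    unchanged, so the tail inherits the bound on h minus a truncation. *)
Lemma sinc_tail e : 0 < e -> exists n0 : nat, forall M, n0%:R <= M ->
  (N (fun x => (sinc x - sinc_trunc M x)%R) <= e%:E)%E.
Proof.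
move=> e0.
have [h [Xh hh]] := ri_complete riN (fun n => inX_sinc_trunc n%:R) sinc_trunc_cauchy.
have mh : measurable_fun (@pos_half R) h := ri_meas riN Xh.
have md : measurable_fun (@pos_half R) (fun x => sinc x - h x).
  by apply: measurable_funB => //; exact: measurable_sinc.
pose w m x := (sinc x - h x) * \1_(`]0, m%:R]%classic : set R) x.
have mw m : measurable_fun (@pos_half R) (w m).
  by apply: measurable_funM => //; apply: measurable_indic; exact: measurable_itv.
have w_in m x : 0 < x -> x <= m%:R -> w m x = sinc x - h x.
  by move=> x0 xM; rewrite /w indicE mem_set ?mulr1//= in_itv/= x0.
have w_out m x : m%:R < x -> w m x = 0.
  by move=> mx; rewrite /w indicE memNset ?mulr0//= in_itv/= => /andP[_]; rewrite leNgt mx.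
(* For n >= m the truncation at n equals sinc on (0, m], so [w m] is dominated by its distance to
   [h]. *)
have Nw m e' : 0 < e' -> (N (w m) < e'%:E)%E.
  move=> e'0; have [n0 hn0] := hh _ e'0.
  pose n := maxn m n0.
  have lt := hn0 n (leq_maxr _ _).
  have X := lt_trans lt (ltry _).
  apply: le_lt_trans lt; apply: (ri_lattice riN) => //.
  move=> x x0; have [xm|xm] := leP x m%:R; last by rewrite w_out// normr0.
  rewrite w_in// sinc_trunc_in//; apply: le_trans xm _.
  by rewrite ler_nat leq_maxl.
have wnull m : mu [set x | 0 < x /\ w m x != 0] = 0%E.
  apply/(ri_eq0 riN); first exact: lt_trans (Nw m _ ltr01) (ltry _).
  apply/eqP; rewrite eq_le (ri_ge0 riN) andbT; apply/lee_addgt0Pr => e' e'0.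
  by rewrite add0e ltW// Nw.
have mwset m : measurable [set x | 0 < x /\ w m x != 0].
  have := measurable_superlevel 0 (mw m); congr (measurable _).
  by apply/seteqP; split => x /= []; rewrite normr_gt0.
have null : mu.-negligible [set x | 0 < x /\ sinc x != h x].
  apply: (@negligibleS _ _ _ mu (\bigcup_m [set x | 0 < x /\ w m x != 0])).
    move=> x [x0 xh]; exists (Num.truncn x).+1 => //; split=> //.
    rewrite w_in ?subr_eq0//; have /andP[_ /ltW] := Num.Theory.truncn_itv (ltW x0).
    by [].
  by apply: negligible_bigcup => m; apply/negligibleP; [exact: mwset|exact: wnull].
have [n0 hn0] := hh _ e0; exists n0 => M nM.
have lt := hn0 n0 (leqnn _).
have X0 : inX N (fun x => sinc_trunc n0%:R x - h x) by exact: lt_trans lt (ltry _).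
have X1 : inX N (fun x => h x - sinc_trunc n0%:R x).
  by rewrite /inX -N_sub_sym.
have le1 : (N (fun x => (sinc x - sinc_trunc n0%:R x)%R) <= e%:E)%E.
  apply: le_trans (ltW lt); rewrite (N_sub_sym X0).
  have ms : measurable_fun (@pos_half R) (fun x => sinc x - sinc_trunc n0%:R x).
    by apply: measurable_funB; [exact: measurable_sinc|exact: measurable_sinc_trunc].
  apply: (ri_distrib riN) => // t t0.
  have [A [mA A0 subA]] := null.
  apply: (@le_trans _ _ (mu ([set x | 0 < x /\ t < `|h x - sinc_trunc n0%:R x|] `|` A))).
    apply: le_measure; rewrite ?inE; [exact: measurable_superlevel| |].
      by apply: measurableU => //; apply: measurable_superlevel; exact: (ri_meas riN).
    move=> x [x0 tx]; have [E|E] := eqVneq (sinc x) (h x).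
      by left; split=> //; rewrite -E.
    by right; apply: subA.
  apply: le_trans (measureU2 _ _ _) _ => //.
    by apply: measurable_superlevel; exact: (ri_meas riN).
  by rewrite -[leRHS]adde0; apply: leeD => //; rewrite le_eqVlt (_ : _ == _)//; exact/eqP.
have X2 := le_lt_trans le1 (ltry _).
apply: le_trans le1; apply: (ri_lattice riN) => //.
- by apply: measurable_funB; [exact: measurable_sinc|exact: measurable_sinc_trunc].
- move=> x x0; have [xM|xM] := leP x M; first by rewrite sinc_trunc_in// subrr normr0.
  by rewrite !sinc_trunc_out// (le_lt_trans nM).
Qed.

End tail.

(** * The decreasing rearrangement of sinc *)

Section rearrangement.
Context {R : realType}.
Implicit Types (s t l : R).
Local Notation F := (distrib (@sinc R)).

(** [rearr] of sinc as a real number: for s >= 0 the level 1 belongs to the set, so the real infimum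
    is meaningful. *)
Definition sinc_rearr s : R := inf [set t : R | 0 < t /\ (F t <= s%:E)%E].

Lemma distrib_sinc1 s : 0 <= s -> (F 1 <= s%:E)%E.
Proof.
move=> s0; apply: distrib_le_itv => //; first exact: measurable_sinc.
by move=> x x0; rewrite ltNge norm_sinc_le1.
Qed.

Lemma has_inf_levels s : 0 <= s -> has_inf [set t : R | 0 < t /\ (F t <= s%:E)%E].
Proof.
move=> s0; split; first by exists 1; split => //; exact: distrib_sinc1.
by exists 0 => t [/ltW].
Qed.

Lemma sinc_rearr_le s t : 0 < t -> (F t <= s%:E)%E -> sinc_rearr s <= t.
Proof. by move=> t0 Ft; apply: ge_inf => //; exists 0 => u [/ltW]. Qed.

Lemma sinc_rearr_ge s t : 0 <= s ->
  (forall u, 0 < u -> (F u <= s%:E)%E -> t <= u) -> t <= sinc_rearr s.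
Proof.
move=> s0 h; apply: lb_le_inf; first by have [] := has_inf_levels s0.
by move=> u [u0 Fu]; exact: h.
Qed.

Lemma sinc_rearr_le1 s : 0 <= s -> sinc_rearr s <= 1.
Proof. by move=> s0; apply: sinc_rearr_le => //; exact: distrib_sinc1. Qed.

Lemma sinc_rearr_decr s t : 0 <= s -> s <= t -> sinc_rearr t <= sinc_rearr s.
Proof.
move=> s0 st; apply: sinc_rearr_ge => // u u0 Fu; apply: sinc_rearr_le => //.
by apply: le_trans Fu _; rewrite lee_fin.
Qed.

Lemma distrib_sinc_rearr_gt s t : 0 <= s -> sinc_rearr s < t -> (F t <= s%:E)%E.
Proof.
move=> s0 /(inf_lt (has_inf_levels s0).1).
move=> [u [u0 Fu] ut]; apply: le_trans Fu.
by apply: distrib_antitone; [exact: measurable_sinc|exact: ltW].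
Qed.

Lemma distrib_sinc_rearr_scale s l : 0 < l -> l < 1 -> 0 < sinc_rearr s ->
  (s%:E <= F (l * sinc_rearr s))%E.
Proof.
move=> l0 l1 r0; rewrite leNgt; apply/negP => /ltW h.
have := sinc_rearr_le (mulr_gt0 l0 r0) h.
by rewrite leNgt gtr_pMl// l1.
Qed.

Lemma gauss_surj t : 0 < t -> t < 1 -> exists2 s, 0 < s & gauss s = t.
Proof.
move=> t0 t1; have [y yE] := expR_total t0.
have y0 : y < 0 by rewrite -expR_lt1 yE.
have p0 := @pi_gt0 R; have z0 : 0 < - 2 * y / pi by rewrite divr_gt0//; lra.
exists (Num.sqrt (- 2 * y / pi)); first by rewrite sqrtr_gt0.
rewrite /gauss sqr_sqrtr; last exact: ltW.
rewrite -yE; congr expR; rewrite [pi * _]mulrC divfK ?gt_eqF//.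
by move: y {yE y0 z0} => y; field.
Qed.

Variable s0 : R.
Hypotheses (s00 : 0 < s0)
  (below : forall s, 0 < s -> s < s0 -> (F (gauss s) <= s%:E)%E)
  (above : forall s, s0 < s -> (s%:E <= F (gauss s))%E).

Lemma sinc_rearr_le_gauss s : 0 <= s -> s < s0 -> sinc_rearr s <= gauss s.
Proof.
rewrite le_eqVlt => /predU1P[<- _|sp ss0].
  by rewrite /gauss expr0n/= mulr0 oppr0 mul0r expR0 sinc_rearr_le1.
by apply: sinc_rearr_le; [exact: gauss_gt0|exact: below].
Qed.

(** A level u < gauss s with F u <= s would give, through a value gauss w between u and gauss s, a
    point w > s with F(gauss w) <= s < w, against [above]. *)
Lemma gauss_le_sinc_rearr s : s0 <= s -> gauss s <= sinc_rearr s.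
Proof.
move=> ss; have sp : 0 < s by exact: lt_le_trans ss.
apply: sinc_rearr_ge; first exact: ltW.
move=> u u0 Fu; rewrite leNgt; apply/negP => ug.
pose v := (u + gauss s) / 2.
have uv : u < v by rewrite /v; lra.
have vg : v < gauss s by rewrite /v; lra.
have g1 : gauss s <= 1.
  rewrite -expR0 ler_expR; have := mulr_ge0 (@pi_ge0 R) (sqr_ge0 s); lra.
have [w w0 wE] := gauss_surj (lt_trans u0 uv) (lt_le_trans vg g1).
have sw : s < w.
  have gw : gauss w < gauss s by rewrite wE.
  by case: (gauss_lt_decr (ltW sp) gw) => //; lra.
have := above (le_lt_trans ss sw); rewrite wE.
have le1 : (F v <= F u)%E by apply: distrib_antitone; [exact: measurable_sinc|exact: ltW].
move=> /le_trans/(_ le1)/le_trans/(_ Fu); rewrite lee_fin; lra.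
Qed.

Lemma sinc_rearr_gt0 s : 0 <= s -> 0 < sinc_rearr s.
Proof.
move=> sp; have h : sinc_rearr (s + s0) <= sinc_rearr s by apply: sinc_rearr_decr => //; rewrite lerDl ltW.
apply: lt_le_trans h; apply: lt_le_trans (gauss_le_sinc_rearr _); first exact: gauss_gt0.
by rewrite lerDr.
Qed.

(** [sum_levels_le] needs level sets of measure at least i d, which holds strictly below the
    rearrangement; hence a factor l < 1, then l close to 1. *)
Lemma sum_sinc_rearr_le (d : R) n : 0 < d ->
  \sum_(1 <= i < n.+1) sinc_rearr (i%:R * d) ^+ 2 * d <= 1 / 2.
Proof.
move=> d0; set S := \sum_(_ <= _ < _) _; have id0 i : 0 <= i%:R * d by rewrite mulr_ge0// ltW.
have h l : 0 < l -> l < 1 -> l ^+ 2 * S <= 1 / 2.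
  move=> l0 l1; apply: le_trans (@sum_levels_le R (fun i => l * sinc_rearr (i%:R * d)) d n d0 _ _ _).
  - rewrite le_eqVlt; apply/orP; left; apply/eqP; rewrite /S mulr_sumr.
    by apply: eq_bigr => i _; ring.
  - by move=> i; rewrite mulr_gt0// sinc_rearr_gt0.
  - move=> i; rewrite ler_pM2l// sinc_rearr_decr// ler_pM2r// ler_nat//.
  - by move=> i; apply: distrib_sinc_rearr_scale => //; exact: sinc_rearr_gt0.
rewrite leNgt; apply/negP => S2.
(* With this value (1 - eta)^2 S > S - 2 eta S = (S + 1/2)/2 > 1/2. *)
pose eta := (S - 1 / 2) / (4 * S).
have eta0 : 0 < eta by rewrite /eta divr_gt0//; lra.
have etaS : eta * (4 * S) = S - 1 / 2 by rewrite /eta divfK// gt_eqF//; lra.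
have eta1 : eta < 1 by rewrite /eta ltr_pdivrMr; lra.
have := h (1 - eta) ltac:(lra) ltac:(lra).
have : 0 <= eta ^+ 2 * S by rewrite mulr_ge0 ?sqr_ge0//; lra.
lra.
Qed.

End rearrangement.

(** * The discretized comparison and the passage to the limit *)

Section comparison.
Context {R : realType}.
Variables (N : (R -> R) -> \bar R).
Hypotheses (riN : ri_space N) (cvxN : exact_2_convex N) (XG : inX N (@gauss R)).
Implicit Types (x t d e M : R) (p q n : nat).
Local Notation mu := (@lebesgue_measure R).
Local Notation F := (distrib (@sinc R)).

(** [gauss_fun] is exp(-x^2), so the squared Gaussian is its rescaling by the root of pi. *)
Lemma gauss_sqr_fun (x d : R) : 0 <= d ->
  gauss (x * d) ^+ 2 = gauss_fun (x * (Num.sqrt pi * d)).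
Proof.
move=> d0; rewrite /gauss /gauss_fun -expRM_natl; congr expR.
by rewrite !exprMn sqr_sqrtr ?pi_ge0//; field.
Qed.

(** Left sums of a decreasing function exceed its integral whatever the mesh, so M0 depends on e
    alone. *)
Lemma sum_gauss_sqr_ge e : 0 < e -> exists2 M0, 0 < M0 & forall n d, 0 < d ->
  M0 <= n%:R * d -> 1 / 2 - e <= \sum_(i < n) gauss (i%:R * d) ^+ 2 * d.
Proof.
move=> e0; have [M1 hM1] := integral_gauss_tail e0.
set r := Num.sqrt pi : R.
have r1 : 1 <= r.
  by rewrite -sqrtr1 ler_wsqrtr//; have := @pi_ge2 R; lra.
have r0 : 0 < r by lra.
exists (Num.max M1 1) => [|n d d0]; first by rewrite lt_max ltr01 orbT.
rewrite ge_max => /andP[M1n _].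
have rd0 : 0 < r * d by rewrite mulr_gt0.
have nd0 : 0 <= n%:R * d by rewrite mulr_ge0// ltW.
have Mn : M1 <= n%:R * (r * d).
  by rewrite mulrCA; apply: le_trans M1n _; rewrite ler_peMl.
have := le_trans (hM1 _ Mn) (integral_gauss_le_sum n rd0); rewrite lee_fin.
have -> : \sum_(i < n) gauss_fun (i%:R * (r * d)) * (r * d) =
    r * \sum_(i < n) gauss (i%:R * d) ^+ 2 * d.
  rewrite mulr_sumr; apply: eq_bigr => i _; rewrite gauss_sqr_fun ?(ltW d0)//.
  by rewrite -/r; ring.
move: (\sum_(_ < _) _) => S; rewrite -/r => h.
have : r * (1 / 2 - e) <= r * S.
  apply: le_trans h; have := ler_wpM2r (ltW e0) r1; lra.
by rewrite ler_pM2l.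
Qed.

(** Across a cell the exponent changes by at most pi (n d) d, and exp(e/2) <= 1 + e because (1 +
    e)(1 - e/2) >= 1. *)
Lemma gauss_left_endpoint (n i : nat) d x e : 0 < d -> 0 < e -> e <= 1 ->
  pi * (n%:R * d) * d <= e / 2 -> (i < n)%N -> cell d i x ->
  gauss (i%:R * d) <= (1 + e) * gauss x.
Proof.
move=> d0 e0 e1 small lt_in /cellP/andP[ix xi].
have p0 := @pi_gt0 R.
have i0 : 0 <= i%:R * d by rewrite mulr_ge0// ltW.
pose z := pi * (n%:R * d) * d.
have nd : i.+1%:R * d <= n%:R * d by rewrite ler_pM2r// ler_nat.
have hz : pi * (x ^+ 2 - (i%:R * d) ^+ 2) / 2 <= z.
  have xd : x - i%:R * d <= d by move: xi; rewrite -(@natr1 _ i) mulrDl mul1r; lra.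
  have : (x - i%:R * d) * (x + i%:R * d) <= d * (2 * (n%:R * d)).
    by apply: ler_pM; [lra|lra|lra|lra].
  move=> /(ler_wpM2l (ltW p0)); rewrite /z; lra.
have -> : gauss (i%:R * d) = gauss x * expR (pi * (x ^+ 2 - (i%:R * d) ^+ 2) / 2).
  by rewrite /gauss -expRD; congr expR; field.
rewrite mulrC ler_pM2r ?gauss_gt0//.
apply: (@le_trans _ _ (expR (e / 2))); first by rewrite ler_expR; apply: le_trans hz _.
rewrite -[leLHS]mul1r -[X in X * _](mulVf (lt0r_neq0 (expR_gt0 (- (e / 2))))).
rewrite -mulrA -expRD addNr expR0 mulr1 -[leLHS]mul1r ler_pdivrMr ?expR_gt0//.
have := ler_wpM2l (ltW (ltr_wpDl ler01 e0)) (expR_ge1Dx (- (e / 2))).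
move: (expR _) => E; nra.
Qed.

Lemma step_scale d n (v : 'I_n -> R) c x : step d (fun i => c * v i) x = c * step d v x.
Proof. by rewrite /step mulr_sumr; apply: eq_bigr => i _; rewrite mulrA. Qed.

Lemma distrib_trunc_le M t : 0 <= M -> (distrib (sinc_trunc M) t <= F t)%E /\
  (0 < t -> (distrib (sinc_trunc M) t <= M%:E)%E).
Proof.
move=> M0; split.
  apply: le_measure; rewrite ?inE.
  - by apply: measurable_superlevel; exact: measurable_sinc_trunc.
  - by apply: measurable_superlevel; exact: measurable_sinc.
  move=> x [x0 tx]; split=> //; have [xM|xM] := leP x M.
    by move: tx; rewrite sinc_trunc_in.
  by move: tx; rewrite sinc_trunc_out// normr0 => /lt_le_trans; apply.
move=> t0; apply: distrib_le_itv => //; first exact: measurable_sinc_trunc.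
move=> x x0 tx; rewrite leNgt; apply/negP => Mx.
by move: tx; rewrite sinc_trunc_out// normr0 ltNge ltW.
Qed.

(* The factor 1 + e makes the levels strict, which avoids continuity of the
   distribution function. *)
Lemma distrib_trunc_le_step n d e t : 0 < d -> 0 < e -> 0 < t ->
  (forall i, 0 < sinc_rearr (i%:R * d : R)) ->
  (distrib (sinc_trunc (n%:R * d)) t <=
   distrib (step d (fun i : 'I_n => ((1 + e) * sinc_rearr (i%:R * d))%R)) t)%E.
Proof.
move=> d0 e0 t0 r0; have nd0 : 0 <= n%:R * d by rewrite mulr_ge0// ltW.
have [leF leM] := distrib_trunc_le t nd0.
rewrite distrib_step ?(ltW t0)//.
pose P i := t < `|(1 + e) * sinc_rearr (i%:R * d)|.
have [/existsP[i0 /negP hi0]|] := boolP [exists i : 'I_n, ~~ P i]; last first.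
  rewrite negb_exists => /forallP h; apply: (le_trans (leM t0)); rewrite lee_fin.
  rewrite (eq_bigr (fun=> d)); first by rewrite sumr_const card_ord mulr_natl.
  by move=> i _; have := h i; rewrite negbK /P => ->.
have ex : exists i, ~~ P i by exists i0; exact/negP.
(* At the first index [k] whose inflated value is at most t, the rearrangement at k d is strictly
   below t, so F t <= k d, while the cells before [k] all count on the right. *)
have [k Pk kmin] := ex_minnP ex.
have kn : (k <= n)%N by apply: leq_trans (kmin i0 _) (ltnW (ltn_ord _)); exact/negP.
apply: (le_trans leF); apply: (@le_trans _ _ (k%:R * d)%:E).
  apply: distrib_sinc_rearr_gt; first by rewrite mulr_ge0// ltW.
  move: Pk; rewrite /P -leNgt => Pk.
  apply: lt_le_trans Pk; rewrite ger0_norm; last by rewrite mulr_ge0 ?(ltW (r0 _))//; lra.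
  by rewrite ltr_pMl//; lra.
rewrite lee_fin; apply: (@le_trans _ _ (\sum_(i < n) if (i < k)%N then d else 0)).
  rewrite -big_mkcond/= -(big_mkord (fun i => (i < k)%N) (fun=> d)).
  by rewrite -(@big_nat_widen _ _ _ 0 k n xpredT) // sumr_const_nat subn0 mulr_natl.
apply: ler_sum => i _; case: ifP => ik; last by case: ifP => _ //; exact: ltW.
case: ifP => // /negbT Pi; have := kmin _ Pi; by rewrite leqNgt ik.
Qed.

(** The three factors 1 + e come from inflating the Gaussian before s0, from replacing points of a
    cell by its left end, and from the strict levels of [distrib_trunc_le_step]. *)
Lemma sinc_trunc_bound e : 0 < e -> e <= 1 -> exists2 M0 : R, 0 < M0 & forall M1 : R, 0 < M1 ->
  exists2 M : R, M1 <= M & (N (sinc_trunc M) <= ((1 + e) ^+ 3 * fine (N (@gauss R)))%:E)%E.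
Proof.
move=> e0 e1; have [s0 [s00 below above]] := @sinc_gauss_crossing R.
have p0 := @pi_gt0 R.
have r0 : forall s : R, 0 <= s -> 0 < sinc_rearr s := sinc_rearr_gt0 s00 above.
set C := fine (N _); have NG : N (@gauss R) = C%:E.
  by rewrite /C fineK// ge0_fin_numE// (ri_ge0 riN).
(* Inflation raises the sum of squares by at least 2 e kap: one half covers the missing Gaussian
   tail, the other the first cell, as d <= e kap. *)
pose kap := s0 * gauss s0 ^+ 2.
have kap0 : 0 < kap by rewrite mulr_gt0// exprn_gt0// gauss_gt0.
have [M0 M00 hM0] := sum_gauss_sqr_ge (mulr_gt0 e0 kap0).
exists M0 => // M1 M10.
have archi z : 0 <= z -> exists2 k, (0 < k)%N & z <= k%:R :> R.
  by move=> z0; exists (Num.truncn z).+1 => //; have /andP[_ /ltW] := Num.Theory.truncn_itv z0.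
(* With mesh s0/p and M = q s0, the crossing point is a cell boundary. [q] fixes M first, and [p] is
   then taken large in terms of M. *)
have [q q0 hq] := archi ((M0 + M1) / s0) ltac:(rewrite divr_ge0//; lra).
pose M := q%:R * s0.
have MM : M0 + M1 <= M by rewrite /M -ler_pdivrMr.
have Mpos : 0 < M by lra.
have ek0 : 0 < e * kap by exact: mulr_gt0.
have q1 : 0 <= s0 / (e * kap) by apply: divr_ge0; exact: ltW.
have Ms0 : 0 < 2 * pi * M * s0.
  by apply: mulr_gt0 => //; apply: mulr_gt0 => //; exact: mulr_gt0.
have q2 : 0 <= 2 * pi * M * s0 / e by apply: divr_ge0; exact: ltW.
have [p pp hp] := archi _ (addr_ge0 q1 q2).
have pR : 0 < p%:R :> R by rewrite ltr0n.
pose d := s0 / p%:R; have d0 : 0 < d by rewrite divr_gt0.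
have pd : p%:R * d = s0 by rewrite /d mulrC divfK ?gt_eqF.
pose n := (p * q)%N.
have nd : n%:R * d = M by rewrite /n /M natrM -pd; ring.
have d_kap : d <= e * kap.
  by rewrite /d ler_pdivrMr// mulrC -ler_pdivrMr//; lra.
have d_small : pi * (n%:R * d) * d <= e / 2.
  rewrite nd /d mulrA ler_pdivrMr//.
  have : 2 * pi * M * s0 / e <= p%:R by lra.
  by rewrite ler_pdivrMr//; lra.
pose a (i : 'I_n) : R := sinc_rearr (i%:R * d).
pose b (i : 'I_n) : R := gauss (i%:R * d).
pose b' (i : 'I_n) : R := if (i < p)%N then (1 + e) * b i else b i.
have id0 (i : nat) : 0 <= i%:R * d by rewrite mulr_ge0// ltW.
have a0 i : 0 < a i by exact: r0.
have b0 i : 0 < b i by exact: gauss_gt0.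
have e10 : 0 < 1 + e by lra.
have b'0 i : 0 < b' i by rewrite /b'; case: ifP => _ //; rewrite mulr_gt0.
have b'le i : b' i <= (1 + e) * b i.
  by rewrite /b'; case: ifP => _ //; rewrite ler_peMl ?ltW//; lra.
have ip (i : nat) : (i < p)%N = (i%:R * d < s0) by rewrite -pd ltr_pM2r// ltr_nat.
have Nb : (N (step d b') <= ((1 + e) ^+ 2 * C)%:E)%E.
  have <- : (N (fun x => ((1 + e) ^+ 2 * gauss x)%R) = ((1 + e) ^+ 2 * C)%:E)%E.
    by rewrite (ri_homog riN)// NG ger0_norm ?sqr_ge0.
  apply: (ri_lattice riN); first by apply: inX_scale.
    exact: measurable_step.
  move=> x x0.
  have eg : 0 <= (1 + e) ^+ 2 * gauss x.
    by apply: mulr_ge0; [exact: sqr_ge0|apply: ltW; exact: gauss_gt0].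
  rewrite [leRHS]ger0_norm//.
  have [[i ci]|h] := pselect (exists i : 'I_n, cell d i x); last first.
    rewrite step_out ?normr0// => i ci.
    by apply: h; exists i.
  rewrite (step_in _ d0 ci) ger0_norm ?(ltW (b'0 i))//; apply: (le_trans (b'le i)).
  rewrite expr2 -mulrA ler_pM2l//.
  exact: (gauss_left_endpoint d0 e0 e1 d_small (ltn_ord i) ci).
have sq (v : 'I_n -> R) : (forall i, 0 < v i) -> step_sqrt d (fun i => v i ^+ 2) = step d v.
  move=> v0; rewrite /step_sqrt; congr step; apply/funext => i.
  by rewrite sqrtr_sqr ger0_norm// ltW.
(* The layer cake bound starts at index 1; the term of index 0 costs at most d since the
   rearrangement is at most 1. *)
have sumA : \sum_i a i ^+ 2 * d <= d + 1 / 2.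
  rewrite -(big_mkord xpredT (fun i => sinc_rearr (i%:R * d) ^+ 2 * d)).
  have n0 : (0 < n)%N by rewrite muln_gt0 pp.
  rewrite -(prednK n0) big_nat_recl// -(big_add1 _ _ 0 n.-1.+1 xpredT (fun i => sinc_rearr (i%:R * d) ^+ 2 * d)).
  rewrite lerD//; last exact: (sum_sinc_rearr_le s00 above).
  by rewrite ger_pMl// exprn_ile1//; [exact: (ltW (r0 _ (id0 0%N)))|exact: (sinc_rearr_le1 (id0 0%N))].
have sumB : \sum_i b i ^+ 2 * d + 2 * (e * kap) <= \sum_i b' i ^+ 2 * d.
  have le i : b i ^+ 2 * d + (if (i < p)%N then 2 * e * gauss s0 ^+ 2 * d else 0) <= b' i ^+ 2 * d.
    rewrite /b'; case: ifP => ilt; last by rewrite addr0.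
    have gb : gauss s0 ^+ 2 <= b i ^+ 2.
      by rewrite lerXn2r ?nnegrE ?ltW ?gauss_gt0// gauss_decr// -ip.
    rewrite -mulrDl ler_pM2r// exprMn.
    have := ler_wpM2l (ltW e0) gb; have := mulr_ge0 (sqr_ge0 e) (sqr_ge0 (b i)); lra.
  apply: (@le_trans _ _ (\sum_(i < n) (b i ^+ 2 * d +
      (if (i < p)%N then 2 * e * gauss s0 ^+ 2 * d else 0)))); last first.
    by apply: ler_sum => i _; exact: le.
  rewrite big_split/= lerD2l.
  rewrite -big_mkcond/= -(big_mkord (fun i => (i < p)%N) (fun=> 2 * e * gauss s0 ^+ 2 * d)).
  have pn : (p <= n)%N by rewrite /n leq_pmulr.
  rewrite -(@big_nat_widen _ _ _ 0 p n xpredT) // sumr_const_nat subn0 -mulr_natl.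
  by rewrite /kap -pd le_eqVlt; apply/orP; left; apply/eqP; ring.
have Na : (N (step d a) <= ((1 + e) ^+ 2 * C)%:E)%E.
  rewrite -(sq a a0); apply: (@ri_majorization _ _ riN cvxN _ _ d0 _ (fun i => b' i ^+ 2)
    (sinc_rearr s0 ^+ 2)).
  - by move=> i; exact: sqr_ge0.
  - by move=> i; exact: sqr_ge0.
  - have rs0 := r0 _ (ltW s00).
    move=> i; have := ip i; case: (ltnP i p) => ilt /esym ids.
      left; rewrite !lerXn2r ?nnegrE ?(ltW (a0 _)) ?(ltW (b'0 _)) ?(ltW rs0)//=.
        by rewrite /b' ilt; apply: (@le_trans _ _ (b i));
          [exact: (sinc_rearr_le_gauss below)|rewrite ler_peMl ?ltW//; lra].
      by apply: sinc_rearr_decr => //; exact: ltW.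
    have sid : s0 <= i%:R * d by rewrite leNgt ids.
    right; rewrite !lerXn2r ?nnegrE ?(ltW (a0 _)) ?(ltW (b'0 _)) ?(ltW rs0)//=.
      by apply: sinc_rearr_decr => //; exact: ltW.
    by rewrite /b' ltnNge ilt; exact: (gauss_le_sinc_rearr s00 above).
  - rewrite -(ler_pM2r d0) !mulr_suml; apply: (le_trans sumA).
    apply: le_trans sumB; have := hM0 n d d0; rewrite nd.
    by move=> /(_ ltac:(lra)); rewrite -/b; lra.
  - by rewrite (sq b' b'0).
exists M; first lra.
have Xa : inX N (step d a) by exact: le_lt_trans Na (ltry _).
have Ea : (fun x => (1 + e) * step d a x) = step d (fun i => (1 + e) * a i).
  by apply/funext => x; rewrite step_scale.
have Xea := inX_scale riN (1 + e) Xa.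
apply: (@le_trans _ _ (N (fun x => ((1 + e) * step d a x)%R))).
  apply: (ri_distrib riN) => //; first exact: measurable_sinc_trunc.
  by move=> t t0; rewrite Ea -nd; apply: distrib_trunc_le_step => // i; exact: r0.
have -> : (1 + e) ^+ 3 * C = (1 + e) * ((1 + e) ^+ 2 * C) by ring.
rewrite (ri_homog riN)// ger0_norm ?(ltW e10)// EFinM.
by apply: lee_wpmul2l => //; rewrite lee_fin ltW.
Qed.

(** Triangle inequality for truncation plus tail: [sinc_trunc_bound] offers arbitrarily large M, so
    one lies past the threshold of [sinc_tail]. *)
Lemma sinc_le_gauss_norm : (N (@sinc R) <= N (@gauss R))%E.
Proof.
set C := fine (N (@gauss R)); have NG : N (@gauss R) = C%:E.
  by rewrite /C fineK// ge0_fin_numE// (ri_ge0 riN).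
have C0 : 0 <= C by apply: fine_ge0; exact: (ri_ge0 riN).
have key e : 0 < e -> e <= 1 -> (N (@sinc R) <= ((1 + e) ^+ 3 * C + e)%:E)%E.
  move=> e0 e1; have [n0 hn0] := sinc_tail riN cvxN XG e0.
  have [M0 M00 /(_ (n0%:R + 1))[|M MM NM]] := sinc_trunc_bound e0 e1.
    by rewrite ltr_wpDl.
  have -> : @sinc R = (fun x => sinc_trunc M x + (sinc x - sinc_trunc M x)).
    by apply/funext => x; ring.
  apply: le_trans (ri_triangle riN _ _) _; rewrite EFinD leeD//.
  apply: hn0; lra.
rewrite NG; apply/lee_addgt0Pr => e e0.
(* As (1 + h)^3 <= 1 + 7 h for h <= 1, the excess over C is at most 7 C h + h <= e. *)
pose h := Num.min 1 (e / (7 * C + 1)).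
have c0 : 0 < 7 * C + 1 by lra.
have h0 : 0 < h by rewrite lt_min ltr01 divr_gt0.
have h1 : h <= 1 by rewrite ge_min lexx.
have h2 : h * (7 * C + 1) <= e by rewrite -ler_pdivlMr// ge_min lexx orbT.
apply: (le_trans (key h h0 h1)); rewrite -EFinD lee_fin.
have h3 : (1 + h) ^+ 3 <= 1 + 7 * h by have := mulr_ge0 (ltW h0) (ltW h0); nra.
have := ler_wpM2r C0 h3; lra.
Qed.

End comparison.

Unset Implicit Arguments.
Set Strict Implicit.
Set Printing Implicit Defensive.

Theorem mainTheorem1 (R : realType) (N : (R -> R) -> \bar R) :
  ri_space N -> exact_2_convex N ->
  (N (fun t : R => (sin (pi * t) / (pi * t))%R)
     <= N (fun t : R => (expR (- (pi * t ^+ 2) / 2))%R))%E.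
Proof.
move=> riN cvxN.
have [XG|] := ltP (N (@gauss R)) +oo%E; first exact: (sinc_le_gauss_norm riN cvxN XG).
by rewrite leye_eq => /eqP E; rewrite -/(@gauss R) E leey.
Qed.
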